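(* Assume the setting described in the context, in particular that $(y,z)\in E$ iff $(z,y)\in E$. For every $(\mu,Q)\in\Lambda$, $$I(\theta\mu,\theta Q;r)=I(\mu,Q;r)+S_{\rm naive}(\mu,Q;r),\quad I(\theta\mu,\theta Q;r^{\rm R})=I(\mu,Q;r)+S_{\rm tot}(Q;r),\quad I(\theta\mu,\theta Q;r^{\rm DR})=I(\mu,Q;r)+S_{\rm ex}(\mu;r).$$ Moreover, for every real $s$, $$\mathcal I_{\rm naive}(-s;r)=\mathcal I_{\rm naive}(s;r)+s,\quad\mathcal I_{\rm tot}(-s;r^{\rm R})=\mathcal I_{\rm tot}(s;r)+s,\quad\mathcal I_{\rm ex}(-s;r^{\rm DR})=\mathcal I_{\rm ex}(s;r)+s.$$
   Context: Let $V$ be a finite set, $T_0>0$, $\mathcal S_{T_0}=\mathbb R/T_0\mathbb Z$. For $y,z\in V$, $r(y,z;\cdot)\ge0$ is measurable, $T_0$-periodic, $r(x,x;\cdot)=0$; $E$ is the set of $(y,z)$, $y\ne z$, with $r(y,z;t)>0$ for all $t>0$, and $r(y,z;t)=0$ for all $t$ if $(y,z)\notin E$ (assumption (A1)). Further assume (A2) $(V,E)$ is strongly connected, (A3) $\sup_{E\times[0,T_0]}r<\infty$, $\inf_{E\times[0,T_0]}r>0$, (A4) the discontinuity points of the rates in $\mathcal S_{T_0}$ form a Lebesgue-null set, and $E$ is symmetric. $r(y;t)=\sum_zr(y,z;t)$. $\mathcal M_*$ = (nonnegative measures on $V\times\mathcal S_{T_0}$ of mass $T_0$) $\times$ (finite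 nonnegative measures on $E\times\mathcal S_{T_0}$). $\Lambda\subset\mathcal M_*$ is the set of $(\mu,Q)$ with $\mu=\mu_tdt$, $\mu_t(V)=1$ a.e., $Q=Q_tdt$, $\int_0^{T_0}\sum_y\mu_s(y)\partial_sf(y,s)ds=\int_0^{T_0}\sum_y[\sum_zQ_s(y,z)-\sum_zQ_s(z,y)]f(y,s)ds$ for all $f$ $C^1$ in time on $V\times\mathcal S_{T_0}$, and, for a.e. $t$, $\mu_t(y)=0\Rightarrow Q_t(y,z)=0$ for all $(y,z)\in E$. $\Phi(q,p)=q\log\frac qp-(q-p)$ for $q,p>0$, $\Phi(0,p)=p$, $\Phi(q,0)=+\infty$ for $q>0$. For any family of $T_0$-periodic rates $r'$ vanishing exactly off $E$, $I(\mu,Q;r')=\int_0^{T_0}\sum_{(y,z)\in E}\Phi(Q_t(y,z),\mu_t(y)r'(y,z;t))dt$ if $(\mu,Q)\in\Lambda$ and $+\infty$ otherwise (the large deviation rate functional of the extended empirical measure and flow for the chain with rates $r'$). $\theta\mu:=\mu_{T_0-t}dt$, $\theta Q:=\tilde Q_tdt$ with $\tilde Q_t(y,z)=Q_{T_0-t}(z,y)$. Reversed protocol: $r^{\rm R}(y,z;t)=r(y,z;T_0-t)$. For each $t$, $w_t$ is the unique invariant distribution of the time-homogeneous chain with frozen rates $r(\cdot,\cdot;t)$ (strictly positive); dual reversed protocol: $r^{\rm DR}(y,z;t)=w_{T_0-t}(y)^{-1}r(z,y;T_0-t)w_{T_0-t}(z)$. Entropy functionals: $S_{\rm naive}(\mu,Q;r)=\sum_{(y,z)\in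 E}\int Q(y,z,ds)\log\frac{r(y,z;s)}{r(z,y;T_0-s)}-\sum_y\int\mu(y,ds)[r(y;s)-r(y;T_0-s)]$; $S_{\rm tot}(Q;r)=\sum_{(y,z)\in E}\int Q(y,z,ds)\log\frac{r(y,z;s)}{r(z,y;s)}$; $S_{\rm ex}(\mu;r)=-\sum_y\int\mu(y,ds)\partial_s\log w_s(y)$. Contracted functionals: $\mathcal I_{\rm naive}(s;r)=\inf\{I(\mu,Q;r):S_{\rm naive}(\mu,Q;r)=s\}$, $\mathcal I_{\rm tot}(s;r)=\inf\{I(\mu,Q;r):S_{\rm tot}(Q;r)=s\}$, $\mathcal I_{\rm ex}(s;r)=\inf\{I(\mu,Q;r):S_{\rm ex}(\mu;r)=s\}$, and likewise with $r$ replaced by $r^{\rm R}$ or $r^{\rm DR}$ (in which case $w$ is replaced by the accompanying distribution of $r^{\rm DR}$, which is $w_{T_0-s}$).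
   Formalization: Since w_s need not be differentiable in s under (A1)–(A4), S_ex(μ;r) is taken in the weak sense −Σ_y∫[Σ_z Q_s(y,z)−Σ_z Q_s(z,y)] log w_s(y) ds, which on Λ equals −Σ_y∫μ(y,ds) ∂_s log w_s(y) whenever log w is C¹ (or absolutely continuous) in time. *)

(* Defs.v *)
From HB Require Import structures.
From mathcomp Require Import all_boot all_order all_algebra.
From mathcomp Require Import all_classical all_reals all_analysis.
Set Implicit Arguments. Unset Strict Implicit. Unset Printing Implicit Defensive.
Import Order.TTheory GRing.Theory Num.Theory.
Import numFieldNormedType.Exports.
Local Open Scope classical_set_scope.
Local Open Scope ring_scope.

Section Defs.
Variables (R : realType) (V : finType).

(* Lebesgue measure on R and the fundamental domain [0,T0] of S_{T0}. *)
Definition leb := (@lebesgue_measure R).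
Definition I0 (T0 : R) : set R := `[0, T0]%classic.

Definition rout (r : V -> V -> R -> R) (y : V) (t : R) : R := \sum_(z : V) r y z t.

Definition rates_assumptions (T0 : R) (E : rel V) (r : V -> V -> R -> R) : Prop :=
  (forall y z, measurable_fun setT (r y z)) /\
      (forall y z t, 0 <= r y z t) /\
      (forall y z t, r y z (t + T0) = r y z t) /\
      (forall x t, r x x t = 0) /\
      (forall y z, E y z <-> (y != z /\ forall t, 0 < t -> 0 < r y z t)) /\
      (forall y z, ~~ E y z -> forall t, r y z t = 0) /\
      (forall y z, connect E y z) /\
      (exists c C : R, 0 < c /\ forall y z t, E y z -> 0 <= t <= T0 ->
          c <= r y z t <= C) /\
      (forall y z, leb [set t | 0 <= t <= T0 /\ ~ {for t, continuous (r y z)}] = 0%E).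

Definition symmetric_E (E : rel V) : Prop := forall y z, E y z = E z y.

Definition invariant_distribution (r : V -> V -> R -> R) (t : R) (p : V -> R) : Prop :=
  [/\ (forall y, 0 <= p y), \sum_(y : V) p y = 1 &
      forall z, \sum_(y : V) p y * r y z t = p z * rout r z t].

Definition test_fun (T0 : R) (f : V -> R -> R) : Prop :=
  forall y, [/\ (forall t, derivable (f y) t 1), continuous (derive1 (f y))
              & forall t, f y (t + T0) = f y t].

Definition divQ (E : rel V) (Q : V -> V -> R -> R) (y : V) (s : R) : R :=
  \sum_(z : V | E y z) Q y z s - \sum_(z : V | E z y) Q z y s.

(* The set Lambda, for (mu, Q) given by their densities mu_t(y), Q_t(y,z)
   on [0,T0]. *)
Definition in_Lambda (T0 : R) (E : rel V) (mu : V -> R -> R)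
    (Q : V -> V -> R -> R) : Prop :=
  (forall y, measurable_fun (I0 T0) (mu y)) /\
      (forall y t, 0 <= t <= T0 -> 0 <= mu y t) /\
      (forall y z, E y z -> measurable_fun (I0 T0) (Q y z)) /\
      (forall y z t, E y z -> 0 <= t <= T0 -> 0 <= Q y z t) /\
      (forall y z, E y z -> leb.-integrable (I0 T0) (EFin \o Q y z)) /\
      {ae leb, forall t, 0 <= t <= T0 -> \sum_(y : V) mu y t = 1} /\
      (forall f, test_fun T0 f ->
        (\int[leb]_(s in I0 T0) (\sum_(y : V) mu y s * derive1 (f y) s)%:E =
         \int[leb]_(s in I0 T0) (\sum_(y : V) divQ E Q y s * f y s)%:E)%E) /\
      {ae leb, forall t, 0 <= t <= T0 -> forall y z, E y z ->
                 mu y t = 0 -> Q y z t = 0}.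

Definition Phi (q p : R) : \bar R :=
  if q == 0 then p%:E
  else if p == 0 then +oo%E
  else (q * ln (q / p) - (q - p))%:E.

Definition Ifun (T0 : R) (E : rel V) (r' : V -> V -> R -> R)
    (mu : V -> R -> R) (Q : V -> V -> R -> R) : \bar R :=
  if `[< in_Lambda T0 E mu Q >] then
    (\int[leb]_(t in I0 T0)
       \sum_(y : V) \sum_(z : V | E y z) Phi (Q y z t) (mu y t * r' y z t))%E
  else +oo%E.

Definition thmu (T0 : R) (mu : V -> R -> R) : V -> R -> R :=
  fun y t => mu y (T0 - t).
Definition thQ (T0 : R) (Q : V -> V -> R -> R) : V -> V -> R -> R :=
  fun y z t => Q z y (T0 - t).

Definition rR (T0 : R) (r : V -> V -> R -> R) : V -> V -> R -> R :=
  fun y z t => r y z (T0 - t).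
Definition rDR (T0 : R) (w : R -> V -> R) (r : V -> V -> R -> R) :
    V -> V -> R -> R :=
  fun y z t => (w (T0 - t) y)^-1 * r z y (T0 - t) * w (T0 - t) z.

Definition S_naive (T0 : R) (E : rel V) (r : V -> V -> R -> R)
    (mu : V -> R -> R) (Q : V -> V -> R -> R) : R :=
  \sum_(y : V) \sum_(z : V | E y z)
      Rintegral leb (I0 T0) (fun s => Q y z s * ln (r y z s / r z y (T0 - s)))
  - \sum_(y : V)
      Rintegral leb (I0 T0) (fun s => mu y s * (rout r y s - rout r y (T0 - s))).

Definition S_tot (T0 : R) (E : rel V) (r : V -> V -> R -> R)
    (Q : V -> V -> R -> R) : R :=
  \sum_(y : V) \sum_(z : V | E y z)
      Rintegral leb (I0 T0) (fun s => Q y z s * ln (r y z s / r z y s)).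

(* S_ex(mu) = - sum_y int mu(y,ds) d_s log w_s(y), where the pairing of mu with
   the time derivative of the (in general only measurable) function log w is
   understood in the weak sense of the continuity equation defining Lambda:
   int mu d_s f = int divQ f. *)
Definition S_ex (T0 : R) (E : rel V) (w : R -> V -> R)
    (Q : V -> V -> R -> R) : R :=
  - \sum_(y : V) Rintegral leb (I0 T0) (fun s => divQ E Q y s * ln (w s y)).

(* contracted functionals; the infimum is taken over all (mu,Q): I = +oo
   outside Lambda *)
Definition I_naive (T0 : R) (E : rel V) (r : V -> V -> R -> R) (s : R) : \bar R :=
  ereal_inf [set e | exists (mu : V -> R -> R) (Q : V -> V -> R -> R),
    S_naive T0 E r mu Q = s /\ e = Ifun T0 E r mu Q].
Definition I_tot (T0 : R) (E : rel V) (r : V -> V -> R -> R) (s : R) : \bar R :=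
  ereal_inf [set e | exists (mu : V -> R -> R) (Q : V -> V -> R -> R),
    S_tot T0 E r Q = s /\ e = Ifun T0 E r mu Q].
Definition I_ex (T0 : R) (E : rel V) (w : R -> V -> R) (r : V -> V -> R -> R)
    (s : R) : \bar R :=
  ereal_inf [set e | exists (mu : V -> R -> R) (Q : V -> V -> R -> R),
    S_ex T0 E w Q = s /\ e = Ifun T0 E r mu Q].

End Defs.

(* Main.v *)
Require Import Defs.
From HB Require Import structures.
From mathcomp Require Import all_boot all_order all_algebra.
From mathcomp Require Import all_classical all_reals all_analysis measurable_realfun.
From mathcomp Require Import ring lra.
Set Implicit Arguments. Unset Strict Implicit. Unset Printing Implicit Defensive.
Import Order.TTheory GRing.Theory Num.Theory.
Import numFieldNormedType.Exports.
Local Open Scope classical_set_scope.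
Local Open Scope ring_scope.

(* Reversing time turns the rate Phi (Q y z) (mu y * r y z) of an edge into
   Phi (Q y z) (mu z * b y z), where b is the reversed edge rate.  The difference
   of the two is an explicit entropy term plus Q y z * (ln (mu y) - ln (mu z)),
   so everything reduces to

     int sum_y div Q_y * ln (mu_y) = 0,

   formally the integral over one period of the time derivative of the entropy
   of mu.  The logarithm is singular where mu vanishes, so mu is replaced by
   mu + del.  The continuity equation makes mu_y a.e. equal to an absolutely
   continuous function with derivative - div Q_y (du Bois-Reymond, by testing
   against smooth ramps at Lebesgue points), the regularised identity is the
   chain rule for that function, and del -> 0 is monotone convergence.

   That time reversal preserves Lambda is the second point: where mu_y vanishes,
   its continuous representative is minimal, hence has zero derivative a.e., so
   the flow into y vanishes together with the flow out of y. *)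

(** * Time reversal on one period *)

(** The obstacle is that the rate functionals may equal [+oo], so the two sides of an identity
    cannot be subtracted. For [del > 0] each edge integral splits into the integral of
    [Phi (Q y z) 1], possibly infinite but the same before and after the swap, and a finite
    remainder. Only the remainders are compared, and [del -> 0] is taken in the extended reals. The
    three protocols differ only in the reversed edge rate [b], which has to be measurable and to lie
    between two positive constants. For the dual protocol this requires an accompanying distribution
    that is measurable in time and bounded below uniformly in time. Since [ln w] need not be
    differentiable in time, [S_ex] is a functional of the flow, through the pairing of its
    divergence with [ln w]. The contracted identities follow because time reversal is an involution
    of Lambda that changes the sign of the entropy functional, while pairs outside Lambda have value
    [+oo]. *)

Section Reflection.
Variables (R : realType) (T0 : R).
Notation leb := (@leb R).
Notation I0 := (@I0 R T0).

Lemma measurable_I0 : measurable I0.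
Proof. exact: measurable_itv. Qed.

Lemma measurable_I0_leb : measurable (I0 : set (measurableTypeR R)).
Proof. exact: measurable_I0. Qed.

Lemma reflectK : involutive (fun t => T0 - t).
Proof. by move=> t; rewrite subKr. Qed.

Lemma measurable_reflect : measurable_fun [set: R] (fun t : R => T0 - t).
Proof. exact: measurable_funB. Qed.

Lemma I0P t : I0 t <-> 0 <= t <= T0.
Proof. by rewrite /Defs.I0 /= in_itv. Qed.

Lemma I0_reflectP t : I0 (T0 - t) <-> I0 t.
Proof.
by rewrite !I0P subr_ge0 lerBlDr lerDl andbC.
Qed.

Lemma preimage_reflect_I0 : (fun t : R => T0 - t) @^-1` I0 = I0.
Proof. by apply/seteqP; split => t /I0_reflectP. Qed.

(** Lebesgue measure is determined by its values on half-open intervals, and the reflection maps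
    such an interval to a half-open one of the same length, closed at the other end. *)
Lemma leb_reflect (A : set R) : measurable A ->
  pushforward leb (fun t : R => T0 - t : measurableTypeR R) A = leb A.
Proof.
move=> mA; symmetry.
have mphi : measurable_fun [set: measurableTypeR R]
    (fun t => T0 - t : measurableTypeR R) by exact: measurable_reflect.
pose phi : {mfun measurableTypeR R >-> measurableTypeR R} :=
  HB.pack (fun t : R => T0 - t : measurableTypeR R)
    (isMeasurableFun.Build _ _ _ _ _ mphi).
apply: (@lebesgue_measure_unique R (pushforward leb phi)) => // X [[a b]/= _ <-].
rewrite /pushforward /=.
have -> : (fun x : R => T0 - x) @^-1` `]a, b]%classic = `[T0 - b, T0 - a[%classic.
  apply/seteqP; split => x /=; rewrite !in_itv/= => /andP[h1 h2]; apply/andP; split.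
  - by rewrite lerBlDr -lerBlDl.
  - by rewrite ltrBrDr -ltrBrDl.
  - by move: h2; rewrite ltrBrDr -ltrBrDl.
  - by move: h1; rewrite lerBlDr -lerBlDl.
rewrite !lebesgue_measure_itv/= !lte_fin.
by rewrite ltrD2l ltrN2 -!EFinD (_ : T0 - a - (T0 - b) = b - a)//; ring.
Qed.

Lemma measurable_fun_reflect d (U : measurableType d) (f : R -> U) :
  measurable_fun I0 f -> measurable_fun I0 (fun t => f (T0 - t)).
Proof.
move=> mf; apply: (@measurable_comp _ _ _ _ _ _ I0 f I0 (fun t : R => T0 - t)) => //.
- exact: measurable_I0.
- by move=> _ [t It <-]; apply/I0_reflectP.
- apply: measurable_funTS; exact: measurable_reflect.
Qed.

Lemma ge0_integral_reflect (f : R -> \bar R) : measurable_fun I0 f ->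
  (forall t, I0 t -> 0 <= f t)%E ->
  (\int[leb]_(t in I0) f (T0 - t)%R = \int[leb]_(t in I0) f t)%E.
Proof.
move=> mf f0.
have mphi : measurable_fun [set: measurableTypeR R]
    (fun t => T0 - t : measurableTypeR R) by exact: measurable_reflect.
rewrite -[in LHS]preimage_reflect_I0.
rewrite -(@ge0_integral_pushforward _ _ _ _ _ _ mphi leb I0 f) //.
- by apply: eq_measure_integral => A mA _; exact: leb_reflect.
- exact: measurable_I0.
- by move=> t /set_mem /f0.
Qed.

(** The positive and the negative part are invariant separately, so the equality also covers
    functions that are not integrable. *)
Lemma integral_reflect (f : R -> \bar R) : measurable_fun I0 f ->
  (\int[leb]_(t in I0) f (T0 - t)%R = \int[leb]_(t in I0) f t)%E.
Proof.
move=> mf; rewrite integralE [RHS]integralE; congr (_ - _)%E.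
- rewrite -(@ge0_integral_reflect (f^\+)%E (measurable_funepos mf) (fun t _ => funepos_ge0 f t)).
  by apply: eq_integral => t _; rewrite !funeposE.
- rewrite -(@ge0_integral_reflect (f^\-)%E (measurable_funeneg mf) (fun t _ => funeneg_ge0 f t)).
  by apply: eq_integral => t _; rewrite !funenegE.
Qed.

Lemma Rintegral_reflect (f : R -> R) : measurable_fun I0 f ->
  Rintegral leb I0 (fun t => f (T0 - t)) = Rintegral leb I0 f.
Proof.
move=> mf; rewrite /Rintegral -(@integral_reflect (EFin \o f)) //.
exact/measurable_EFinP.
Qed.

Lemma integrable_reflect (f : R -> R) : leb.-integrable I0 (EFin \o f) ->
  leb.-integrable I0 (EFin \o (fun t => f (T0 - t))).
Proof.
move=> /integrableP[mf fi]; apply/integrableP; split.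
  exact: (measurable_fun_reflect mf).
rewrite (@integral_reflect (fun t => `|(f t)%:E|%E)) //.
exact: measurableT_comp.
Qed.

Lemma ae_reflect (P : R -> Prop) : {ae leb, forall t, P t} ->
  {ae leb, forall t, P (T0 - t)}.
Proof.
move=> [N [mN N0 PN]]; exists ((fun t : R => T0 - t) @^-1` N); split.
- rewrite -[X in measurable X]setTI; exact: measurable_reflect.
- by have := leb_reflect mN; rewrite /pushforward => ->.
- by move=> t /= Pt; apply: PN.
Qed.

End Reflection.

(** * Periodic C1 test functions *)

Section QuadraticRemainder.
Variable R : realType.
Implicit Types F : R -> R.

(** A remainder bound valid for all increments can be checked on piecewise quadratic functions by
    cases on signs, with no gluing of derivatives where the pieces meet. *)
Lemma quadratic_remainder_is_derive F (x l C : R) :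
  (forall h, `|F (x + h) - F x - h * l| <= C * h ^+ 2) -> is_derive x 1 F l.
Proof.
move=> Fq.
have C0 : 0 <= C.
  by have := Fq 1; rewrite expr1n mulr1; apply: le_trans.
have cv : h^-1 *: (F (h *: (1 : R) + x) - F x) @[h --> 0^'] --> l.
  apply/cvgrPdist_le => /= e e0; near=> h.
  have h0 : h != 0 by near: h; exact: nbhs_dnbhs_neq.
  rewrite distrC /GRing.scale /= mulr1 [h + x]addrC.
  have -> : h^-1 * (F (x + h) - F x) - l = h^-1 * (F (x + h) - F x - h * l).
    by field.
  rewrite normrM normfV ler_pdivrMl ?normr_gt0//.
  apply: (le_trans (Fq h)); rewrite -real_normK ?num_real// expr2 mulrCA.
  rewrite ler_wpM2l//.
  (* [C + 1] keeps the divisor positive when [C = 0]. *)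
  have : `|h| <= e / (C + 1).
    near: h; apply: dnbhs0_le; rewrite divr_gt0// ltr_wpDl//.
  rewrite ler_pdivlMr ?ltr_wpDl// => hK; apply: le_trans hK.
  by rewrite mulrDr mulr1 mulrC lerDl.
split; first by apply/cvg_ex; exists l.
exact/cvg_lim.
Unshelve. all: by end_near. Qed.

Lemma lipschitz_continuous F (K : R) :
  (forall x h, `|F (x + h) - F x| <= K * `|h|) -> continuous F.
Proof.
move=> FK x.
have K0 : 0 <= K by have := FK x 1; rewrite normr1 mulr1; apply: le_trans.
apply/cvgrPdist_le => /= e e0; near=> y.
rewrite distrC -[y in F y](subrKC x); apply: (le_trans (FK _ _)).
have : `|y - x| <= e / (K + 1).
  rewrite distrC; near: y; apply: cvgr_dist_le => //.
  by rewrite divr_gt0// ltr_wpDl.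
rewrite ler_pdivlMr ?ltr_wpDl// => hK; apply: le_trans hK.
by rewrite mulrDr mulr1 mulrC lerDl.
Unshelve. all: by end_near. Qed.

End QuadraticRemainder.

Section Periodization.
Variables (R : realType) (T0 T1 : R) (F F' : R -> R) (C K : R).
Hypotheses (T1_gt0 : 0 < T1) (T1_lt : T1 < T0).
Hypothesis Fq : forall x h, `|F (x + h) - F x - h * F' x| <= C * h ^+ 2.
Hypothesis F'K : forall x h, `|F' (x + h) - F' x| <= K * `|h|.
Hypothesis Fl : forall t, t <= 0 -> F t = 0.
Hypothesis Fr : forall t, T1 <= t -> F t = 0.
Hypothesis F'l : forall t, t <= 0 -> F' t = 0.
Hypothesis F'r : forall t, T1 <= t -> F' t = 0.

Let T0_gt0 : 0 < T0. Proof. exact: lt_trans T1_lt. Qed.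

(** [F] read at the representative of [t] in [0, T0[. As [F] vanishes outside [0, T1], this is also
    the sum of all translates of [F] by multiples of [T0]. *)
Definition periodize (t : R) : R := F (t - (Num.floor (t / T0))%:~R * T0).

Let floor_bounds t : (Num.floor (t / T0))%:~R * T0 <= t <
  ((Num.floor (t / T0))%:~R + 1) * T0.
Proof.
have /andP[h1 h2] := floor_itv (t / T0).
by rewrite -ler_pdivlMr// h1 -ltr_pdivrMr//; move: h2; rewrite intrD.
Qed.

Let floor_eq t (k : int) : k%:~R * T0 <= t < (k%:~R + 1) * T0 ->
  Num.floor (t / T0) = k.
Proof.
move=> /andP[h1 h2]; apply: floor_def; rewrite intrD ler_pdivlMr// h1/=.
by rewrite ltr_pdivrMr.
Qed.

(* Since F vanishes on both sides of [0, T1], the unperiodised formula stays valid on an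
   open interval around [k T0, (k + 1) T0[; this gives smoothness also at the
   multiples of T0. *)
Let periodizeE (k : int) s :
  k%:~R * T0 - (T0 - T1) < s < (k%:~R + 1) * T0 -> periodize s = F (s - k%:~R * T0).
Proof.
move=> /andP[h1 h2]; rewrite /periodize.
have [ks|sk] := leP (k%:~R * T0) s.
  by rewrite (@floor_eq s k)// ks h2.
rewrite (@floor_eq s (k - 1)).
  rewrite intrB Fr; first by rewrite Fl// subr_le0 ltW.
  by move: h1; lra.
rewrite intrB; apply/andP; split; last by move: sk; lra.
by move: h1 T1_gt0; lra.
Qed.

Let near_periodize (k : int) t :
  k%:~R * T0 - (T0 - T1) < t < (k%:~R + 1) * T0 ->
  \forall s \near t, k%:~R * T0 - (T0 - T1) < s < (k%:~R + 1) * T0.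
Proof.
move=> /andP[h1 h2]; near=> s; apply/andP; split.
  by near: s; exact: lt_nbhsr.
by near: s; exact: lt_nbhsl.
Unshelve. all: by end_near. Qed.

Let is_derive_periodize (k : int) t :
  k%:~R * T0 - (T0 - T1) < t < (k%:~R + 1) * T0 ->
  is_derive t 1 periodize (F' (t - k%:~R * T0)).
Proof.
move=> tk; apply: (@near_eq_is_derive _ _ _ (fun s => F (s - k%:~R * T0))).
  by apply: filterS (near_periodize tk) => s /periodizeE ->.
apply: (@quadratic_remainder_is_derive _ _ _ _ C) => h.
by rewrite (addrAC t h); exact: Fq.
Qed.

Let floor_nbhs t :
  (Num.floor (t / T0))%:~R * T0 - (T0 - T1) < t < ((Num.floor (t / T0))%:~R + 1) * T0.
Proof.
have /andP[h1 ->] := floor_bounds t; rewrite andbT.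
by apply: lt_le_trans h1; rewrite ltrBlDr ltrDl subr_gt0.
Qed.

Lemma derivable_periodize t : derivable periodize t 1.
Proof. by have [] := is_derive_periodize (floor_nbhs t). Qed.

Let derive1_periodize (k : int) t :
  k%:~R * T0 - (T0 - T1) < t < (k%:~R + 1) * T0 ->
  derive1 periodize t = F' (t - k%:~R * T0).
Proof. by move=> /is_derive_periodize[_]; rewrite derive1E. Qed.

Lemma continuous_derive1_periodize : continuous (derive1 periodize).
Proof.
move=> t; have tk := floor_nbhs t; set k := Num.floor (t / T0) in tk.
rewrite /continuous_at (derive1_periodize tk).
apply: (@cvg_trans _ ((fun s => F' (s - k%:~R * T0)) @ t)).
  apply: near_eq_cvg; apply: filterS (near_periodize tk) => s sk /=.
  by rewrite (derive1_periodize sk).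
apply: (@lipschitz_continuous _ (fun s => F' (s - k%:~R * T0)) K) => x h.
by rewrite (addrAC x h); exact: F'K.
Qed.

Lemma periodize_periodic t : periodize (t + T0) = periodize t.
Proof.
rewrite /periodize mulrDl divff ?gt_eqF// floorDrz ?int_num1// floor1 intrD.
by congr F; rewrite mulrDl mul1r opprD addrACA subrr addr0.
Qed.

Lemma periodize_I0 t : 0 <= t <= T0 -> periodize t = F t.
Proof.
move=> /andP[t0]; rewrite le_eqVlt => /predU1P[->|tT].
  (* The endpoint [T0] is represented by 0, and [F] vanishes at both. *)
  rewrite -[T0]add0r periodize_periodic add0r Fr ?ltW//.
  by rewrite /periodize mul0r floor0 mul0r subr0 Fl.
rewrite (@periodizeE 0) ?mul0r ?subr0//.
by apply/andP; split; [move: t0 T1_lt; lra|rewrite mulr0z add0r mul1r].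
Qed.

Lemma derive1_periodize_I0 t : 0 <= t <= T0 -> derive1 periodize t = F' t.
Proof.
move=> /andP[t0]; rewrite le_eqVlt => /predU1P[->|tT].
  rewrite (@derive1_periodize 1); first by rewrite mul1r subrr F'l// F'r// ltW.
  by rewrite mulr1z; apply/andP; split; move: T1_lt T0_gt0; lra.
rewrite (@derive1_periodize 0) ?mul0r ?subr0//.
by apply/andP; split; [move: t0 T1_lt; lra|rewrite mulr0z add0r mul1r].
Qed.

End Periodization.

(** * Smooth steps with tent-shaped derivative *)

Section Ramp.
Variable R : realType.
Implicit Types x h s e : R.

Definition pos x : R := Num.max x 0.
(** A primitive of [pos]: second differences of [hsq] are C1 steps, and those of [pos] are their
    derivatives. *)
Definition hsq x : R := pos x ^+ 2 / 2.

Lemma posP x : (0 <= x /\ pos x = x) \/ (x < 0 /\ pos x = 0).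
Proof. by rewrite /pos; have [h|h] := ltP x 0; [right|left]. Qed.

Lemma hsq_quadratic x h : `|hsq (x + h) - hsq x - h * pos x| <= h ^+ 2.
Proof.
rewrite /hsq ler_norml; apply/andP.
by have [[? ->]|[? ->]] := posP (x + h); have [[? ->]|[? ->]] := posP x;
  split; nra.
Qed.

Lemma pos_lipschitz x h : `|pos (x + h) - pos x| <= `|h|.
Proof.
have : - `|h| <= h <= `|h| by rewrite -ler_norml.
move=> /andP[h1 h2]; rewrite ler_norml; apply/andP.
by have [[? ->]|[? ->]] := posP (x + h); have [[? ->]|[? ->]] := posP x;
  split; lra.
Qed.

(* Second difference of [hsq]: a C1 step from 0 to 1 over [0, 2 e], whose derivative
   [dramp] is the tent of height 1 / e on that interval. *)
Definition ramp e s : R := (hsq s - 2 * hsq (s - e) + hsq (s - 2 * e)) / e ^+ 2.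
Definition dramp e s : R := (pos s - 2 * pos (s - e) + pos (s - 2 * e)) / e ^+ 2.

(** The constant is 4 = 1 + 2 + 1, the sum of the absolute coefficients of a second difference. *)
Lemma ramp_quadratic e s h : 0 < e ->
  `|ramp e (s + h) - ramp e s - h * dramp e s| <= 4 / e ^+ 2 * h ^+ 2.
Proof.
move=> e0; rewrite /ramp /dramp.
have := hsq_quadratic s h; have := hsq_quadratic (s - e) h.
have := hsq_quadratic (s - 2 * e) h.
rewrite ![_ - _ + h]addrAC; rewrite !ler_norml => /andP[a1 a2] /andP[b1 b2] /andP[c1 c2].
have e2 : 0 < e ^+ 2 by rewrite exprn_gt0.
set X := (X in _ <= X <= _).
have -> : X = ((hsq (s + h) - hsq s - h * pos s)
   - 2 * (hsq (s + h - e) - hsq (s - e) - h * pos (s - e))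
   + (hsq (s + h - 2 * e) - hsq (s - 2 * e) - h * pos (s - 2 * e))) / e ^+ 2.
  by rewrite /X; ring.
rewrite [4 / _ * _]mulrAC -[- (4 * _ / _)]mulNr.
rewrite !ler_pM2r ?invr_gt0//.
by apply/andP; split; lra.
Qed.

Lemma dramp_lipschitz e s h : 0 < e ->
  `|dramp e (s + h) - dramp e s| <= 4 / e ^+ 2 * `|h|.
Proof.
move=> e0; rewrite /dramp -mulrBl normrM normfV [`|e ^+ 2|]ger0_norm ?exprn_ge0 ?(ltW e0)//.
rewrite [leRHS]mulrAC ler_pM2r ?invr_gt0 ?exprn_gt0//.
have := pos_lipschitz s h; have := pos_lipschitz (s - e) h.
have := pos_lipschitz (s - 2 * e) h.
rewrite ![_ - _ + h]addrAC !(ler_norml _ `|h|) ler_norml => /andP[a1 a2] /andP[b1 b2] /andP[c1 c2].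
by apply/andP; split; lra.
Qed.

Lemma ramp_left e s : 0 < e -> s <= 0 -> ramp e s = 0 /\ dramp e s = 0.
Proof.
move=> e0 s0; rewrite /ramp /dramp /hsq.
have -> : pos s = 0 by rewrite /pos max_r.
have -> : pos (s - e) = 0 by rewrite /pos max_r//; lra.
have -> : pos (s - 2 * e) = 0 by rewrite /pos max_r//; lra.
by rewrite expr0n/= !mul0r !mulr0 subrr addr0 mul0r.
Qed.

Lemma ramp_right e s : 0 < e -> 2 * e <= s -> ramp e s = 1 /\ dramp e s = 0.
Proof.
move=> e0 s0; rewrite /ramp /dramp /hsq.
have -> : pos s = s by rewrite /pos max_l//; lra.
have -> : pos (s - e) = s - e by rewrite /pos max_l//; lra.
have -> : pos (s - 2 * e) = s - 2 * e by rewrite /pos max_l//; lra.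
by split; field; rewrite gt_eqF.
Qed.

Lemma ramp_bounds e s : 0 < e -> 0 <= ramp e s <= 1.
Proof.
move=> e0; rewrite /ramp /hsq; have e2 : 0 < e ^+ 2 by rewrite exprn_gt0.
rewrite ler_pdivlMr// mul0r ler_pdivrMr// mul1r.
by have [[? ->]|[? ->]] := posP s; have [[? ->]|[? ->]] := posP (s - e);
  have [[? ->]|[? ->]] := posP (s - 2 * e); apply/andP; split; nra.
Qed.

Lemma dramp_bounds e s : 0 < e -> 0 <= dramp e s <= e^-1.
Proof.
move=> e0; rewrite /dramp; have e2 : 0 < e ^+ 2 by rewrite exprn_gt0.
rewrite ler_pdivlMr// mul0r ler_pdivrMr// expr2 mulKf ?gt_eqF//.
by have [[? ->]|[? ->]] := posP s; have [[? ->]|[? ->]] := posP (s - e);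
  have [[? ->]|[? ->]] := posP (s - 2 * e); apply/andP; split; lra.
Qed.

Lemma continuous_ramp_shift e (a : R) : 0 < e -> continuous (fun t => ramp e (t - a)).
Proof.
move=> e0 x.
have : is_derive x 1 (fun t => ramp e (t - a)) (dramp e (x - a)).
  apply: (@quadratic_remainder_is_derive _ _ _ _ (4 / e ^+ 2)) => h.
  by rewrite (addrAC x h); exact: ramp_quadratic.
by move=> [/derivable1_diffP /differentiable_continuous].
Qed.

Lemma continuous_dramp_shift e (a : R) : 0 < e -> continuous (fun t => dramp e (t - a)).
Proof.
move=> e0; apply: (@lipschitz_continuous _ _ (4 / e ^+ 2)) => x h.
by rewrite (addrAC x h); exact: dramp_lipschitz.
Qed.

End Ramp.

(** * The weak time derivative *)

Section IntegralTools.
Context {dd : measure_display} {T : measurableType dd} {R : realType}.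
Variable mu : {measure set T -> \bar R}.

Lemma integrable_measurable_fun (D : set T) (f : T -> R) :
  mu.-integrable D (EFin \o f) -> measurable_fun D f.
Proof. by move=> /integrableP[/measurable_EFinP]. Qed.

Lemma integrableM_bounded (D : set T) (f h : T -> R) (C : R) : measurable D ->
  mu.-integrable D (EFin \o f) -> measurable_fun D h ->
  (forall x, D x -> `|h x| <= C) ->
  mu.-integrable D (EFin \o (fun x => f x * h x)).
Proof.
move=> mD fi mh hC.
apply: (le_integrable mD _ _ (integrableZl mD C fi)).
  apply/measurable_EFinP; apply: measurable_funM => //.
  exact: integrable_measurable_fun.
move=> x Dx /=; rewrite lee_fin !normrM mulrC ler_wpM2r//.
exact: le_trans (hC x Dx) (ler_norm _).
Qed.

Lemma bounded_integrable (D : set T) (h : T -> R) (C : R) : measurable D ->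
  (mu D < +oo)%E -> measurable_fun D h -> (forall x, D x -> `|h x| <= C) ->
  mu.-integrable D (EFin \o h).
Proof.
move=> mD Dfin mh hC; apply: measurable_bounded_integrable => //.
exists C; split; first exact: num_real.
by move=> M CM x Dx /=; rewrite (le_trans (hC x Dx))// ltW.
Qed.

Lemma integrable_cstM (D : set T) (f : T -> R) (c : R) : measurable D ->
  mu.-integrable D (EFin \o f) -> mu.-integrable D (EFin \o (fun x => c * f x)).
Proof. by move=> mD fi; have := integrableZl mD c fi. Qed.

Lemma integrableB_real (D : set T) (f g : T -> R) : measurable D ->
  mu.-integrable D (EFin \o f) -> mu.-integrable D (EFin \o g) ->
  mu.-integrable D (EFin \o (fun x => f x - g x)).
Proof. by move=> mD fi gi; have := integrableB mD fi gi. Qed.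

Lemma integrable_normr (D : set T) (f : T -> R) : measurable D ->
  mu.-integrable D (EFin \o f) -> mu.-integrable D (EFin \o (fun x => `|f x|)).
Proof. by move=> mD fi; have := integrable_abse fi. Qed.

Lemma measurable_fun_patch (D : set T) (f : T -> \bar R) : measurable D ->
  measurable_fun D f -> measurable_fun setT (f \_ D).
Proof. by move=> mD mf; apply/(measurable_restrictT f mD). Qed.

Lemma measurable_funT_patch (D : set T) (f : T -> \bar R) : measurable D ->
  measurable_fun setT f -> measurable_fun setT (f \_ D).
Proof. by move=> mD mf; apply: measurable_fun_patch => //; exact: measurable_funTS. Qed.

End IntegralTools.

Lemma leb_I0_lty (R : realType) (T0 : R) : (leb (@I0 R T0) < +oo)%E.
Proof.
by rewrite /leb /I0 lebesgue_measure_itv/=; case: ifP => // _; rewrite -EFinD ltry.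
Qed.

Section WeakDerivative.
Variables (R : realType) (T0 : R).
Hypothesis T0_gt0 : 0 < T0.
Notation leb := (@leb R).
Notation I0 := (@I0 R T0).
Variables (m d : R -> R).
Hypothesis mi : leb.-integrable I0 (EFin \o m).
Hypothesis di : leb.-integrable I0 (EFin \o d).
Hypothesis weak : forall f : R -> R, (forall t, derivable f t 1) ->
  continuous (derive1 f) -> (forall t, f (t + T0) = f t) ->
  Rintegral leb I0 (fun t => m t * derive1 f t) =
  Rintegral leb I0 (fun t => d t * f t).

Lemma measurable_fun_dramp (D : set R) e a : 0 < e ->
  measurable_fun D (fun t => dramp e (t - a)).
Proof.
move=> e0; apply: measurable_funTS; apply: continuous_measurable_fun.
exact: continuous_dramp_shift.
Qed.

Lemma measurable_fun_ramp (D : set R) e a : 0 < e ->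
  measurable_fun D (fun t => ramp e (t - a)).
Proof.
move=> e0; apply: measurable_funTS; apply: continuous_measurable_fun.
exact: continuous_ramp_shift.
Qed.

Lemma integral_dramp e a : 0 < e -> 0 < a -> a + 2 * e < T0 ->
  Rintegral leb I0 (fun t => dramp e (t - a)) = 1.
Proof.
move=> e0 a0 aT.
have dF (x : R) : is_derive x 1 (fun t => ramp e (t - a)) (dramp e (x - a)).
  apply: (@quadratic_remainder_is_derive _ _ _ _ (4 / e ^+ 2)) => h.
  by rewrite (addrAC x h); exact: ramp_quadratic.
rewrite /Rintegral /Defs.I0 (@continuous_FTC2 _ _ (fun t => ramp e (t - a)))//=.
- rewrite (ramp_right e0 _).1; last by lra.
  by rewrite (ramp_left e0 _).1 ?subr0//; lra.
- by apply: continuous_subspaceT; exact: continuous_dramp_shift.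
- split.
  + by move=> x _; have [] := dF x.
  + by apply: cvg_at_right_filter; exact: continuous_ramp_shift.
  + by apply: cvg_at_left_filter; exact: continuous_ramp_shift.
- by move=> x _; rewrite derive1E; have [] := dF x.
Qed.

Lemma integrable_m_dramp e a : 0 < e ->
  leb.-integrable I0 (EFin \o (fun t => m t * dramp e (t - a))).
Proof.
move=> e0; apply: (integrableM_bounded (C := e^-1)) => //.
- exact: measurable_I0_leb.
- exact: measurable_fun_dramp.
- by move=> t _; have /andP[h1 h2] := dramp_bounds (t - a) e0; rewrite ger0_norm.
Qed.

(** The tent has mass one, is at most [1 / e] and vanishes outside the ball of radius [2 e], whose
    length is [4 e]. The weighted deviation from [m a] is therefore at most 4 times the mean
    deviation over that ball, which tends to 0 at Lebesgue points. *)
Lemma kernel_davg_bound e a : 0 < e -> 0 < a -> a + 2 * e < T0 ->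
  (`|Rintegral leb I0 (fun t => m t * dramp e (t - a)) - m a|%:E <=
   4%:E * davg (m \_ I0) a (2 * e)%R)%E.
Proof.
move=> e0 a0 aT.
have mI0 := @measurable_I0_leb R T0.
have Ia : I0 a by apply/I0P; apply/andP; split; lra.
have id : leb.-integrable I0 (EFin \o (fun t => dramp e (t - a))).
  apply: (bounded_integrable (C := e^-1)) => //.
  - exact: leb_I0_lty.
  - exact: measurable_fun_dramp.
  - by move=> t _; have /andP[h1 h2] := dramp_bounds (t - a) e0; rewrite ger0_norm.
have ima : leb.-integrable I0 (EFin \o (fun t => m a * dramp e (t - a))).
  exact: integrable_cstM.
have -> : Rintegral leb I0 (fun t => m t * dramp e (t - a)) - m a =
    Rintegral leb I0 (fun t => m t * dramp e (t - a) - m a * dramp e (t - a)).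
  rewrite RintegralB//; last exact: integrable_m_dramp.
  by rewrite RintegralZl// integral_dramp// mulr1.
have iB : leb.-integrable I0 (EFin \o (fun t => m t * dramp e (t - a) - m a * dramp e (t - a))).
  by apply: integrableB_real => //; exact: integrable_m_dramp.
rewrite EFin_normr_Rintegral//.
apply: (le_trans (le_abse_integral leb mI0 (measurable_int leb iB))).
have mm : measurable_fun setT (m \_ I0).
  have mfm := integrable_measurable_fun mi.
  by apply/(measurable_restrictT _ _).1 => //; exact: measurable_I0.
have mball : measurable (ball a (2 * e) : set (measurableTypeR R)).
  exact: measurable_ball.
have mc : measurable_fun [set: measurableTypeR R]
    (fun t => `|((center ((m \_ I0) a) \o m \_ I0) t)%:E|%E).
  apply: measurableT_comp => //; apply/measurable_EFinP.
  by rewrite /comp; apply: measurable_funB.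
have mcb : measurable_fun [set: measurableTypeR R]
    ((fun t => `|((center ((m \_ I0) a) \o m \_ I0) t)%:E|%E) \_ (ball a (2 * e))).
  exact: (measurable_funT_patch mball mc).
have mI : measurable_fun [set: measurableTypeR R] ((fun x => `|(EFin \o
    (fun t : R => m t * dramp e (t - a) - m a * dramp e (t - a))%R) x|%E) \_ I0).
  apply: (measurable_fun_patch mI0).
  by apply: measurableT_comp => //; exact: (measurable_int leb iB).
rewrite /davg /iavg lebesgue_measure_ball; last by rewrite mulr_ge0 ?(ltW e0).
rewrite inver gt_eqF ?mulrn_wgt0 ?mulr_gt0//.
rewrite muleA -EFinM.
have -> : 4 * (2 * e *+ 2)^-1 = e^-1 :> R by rewrite -mulr_natr; field; rewrite gt_eqF.
rewrite integral_mkcond [in leRHS]integral_mkcond.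
rewrite -ge0_integralZl//; last 2 first.
- by move=> t _; rewrite erestrict_ge0.
- by rewrite lee_fin invr_ge0 ltW.
apply: ge0_le_integral => //.
- by move=> t _; rewrite erestrict_ge0.
- exact: emeasurable_funM.
move=> t _; rewrite !patchE.
case: ifPn => [/set_mem It|_]; last first.
  by case: ifPn => _; rewrite ?mule0// mule_ge0// lee_fin ?invr_ge0 ?(ltW e0).
rewrite /= (mem_set Ia) -mulrBl normrM.
have [h0|h0] := leP (t - a) 0.
  rewrite (ramp_left e0 h0).2 normr0 mulr0.
  by case: ifPn => _; rewrite ?mule0// mule_ge0// lee_fin ?invr_ge0 ?(ltW e0).
have [h1|h1] := leP (2 * e) (t - a).
  rewrite (ramp_right e0 h1).2 normr0 mulr0.
  by case: ifPn => _; rewrite ?mule0// mule_ge0// lee_fin ?invr_ge0 ?(ltW e0).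
rewrite mem_set /=; last by rewrite /ball/= distrC gtr0_norm.
rewrite patchE (mem_set It) -EFinM lee_fin mulrC ler_wpM2r//.
by have /andP[k1 k2] := dramp_bounds (t - a) e0; rewrite ger0_norm.
Qed.

Lemma kernel_cvg (u : nat -> R) a : (forall n, 0 < u n) -> u @ \oo --> 0 ->
  0 < a < T0 -> (forall n, a + 2 * u n < T0) -> lebesgue_pt (m \_ I0) a ->
  Rintegral leb I0 (fun t => m t * dramp (u n) (t - a)) @[n --> \oo] --> m a.
Proof.
move=> u0 ucv /andP[a0 aT] uT la.
(* Lebesgue points are defined by a limit along positive radii, hence the filter [0^'+]. *)
have u2 : (2 * u n) @[n --> \oo] --> (0 : R)^'+.
  have u20 : (2 * u n) @[n --> \oo] --> (0 : R).
    by rewrite -(mulr0 2); apply: cvgM => //; exact: cvg_cst.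
  move=> P [e e0 eP]; move/cvgrPdist_lt : u20 => /(_ e e0) u2e.
  apply: (@filterS _ (\oo : set_system nat) _ _ _ _ u2e) => n hn.
  by apply: eP; rewrite //= mulr_gt0.
have dv : (4%:E * davg (m \_ I0) a (2 * u n)%R)%E @[n --> \oo] --> 0%E.
  rewrite -(mule0 4%:E); apply: cvgeZl => //.
  exact: (cvg_comp _ _ u2 la).
have nd : `|Rintegral leb I0 (fun t => m t * dramp (u n) (t - a)) - m a|%:E @[n --> \oo] --> 0%E.
  apply: (@squeeze_cvge _ _ _ _ (fun=> 0%E)); last exact: dv.
    by near=> n; rewrite lee_fin normr_ge0/=; exact: kernel_davg_bound.
  exact: cvg_cst.
apply/cvgrPdist_le => /= e e0.
move/fine_cvgP : nd => [_] /cvgrPdist_le /(_ e e0).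
apply: filterS => n /=; rewrite sub0r normrN normr_id distrC; exact.
Unshelve. all: by end_near. Qed.

(** For each [s] the sequence is eventually constant. The value 0 at [s = 0] is what makes a
    difference of two ramps converge to the indicator of the half-open interval []a, b]]. *)
Lemma ramp_cvg (u : nat -> R) s : (forall n, 0 < u n) -> u @ \oo --> 0 ->
  ramp (u n) s @[n --> \oo] --> (if 0 < s then 1 else 0 : R).
Proof.
move=> u0 ucv; case: ifPn => [s0|]; last first.
  rewrite -leNgt => s0; apply: cvg_near_cst; near=> n.
  by rewrite (ramp_left _ s0).1.
apply: cvg_near_cst; near=> n; rewrite (ramp_right _ _).1//.
rewrite -ler_pdivlMl// ltW//; near: n.
by apply: (cvgr_lt 0) => //; rewrite mulrC divr_gt0.
Unshelve. all: by end_near. Qed.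

(** The test function is a ramp starting at [a] minus a ramp starting at [b]. The two tents recover
    [m a] and [m b] at Lebesgue points, while the ramps converge to the indicator of []a, b]] with
    [|d|] as dominating function. *)
Lemma weak_increment a b : 0 < a -> a < b -> b < T0 ->
  lebesgue_pt (m \_ I0) a -> lebesgue_pt (m \_ I0) b ->
  m a - m b = Rintegral leb `]a, b] d.
Proof.
move=> a0 ab bT la lb.
have mI0 := @measurable_I0_leb R T0.
(* The factor [(T0 - b) / 3] makes the second ramp, of width [2 * u n], end before [T0], so that the
   test function can be made periodic. *)
pose u n : R := (T0 - b) / 3 * harmonic n.
have u0 n : 0 < u n by rewrite /u mulr_gt0 ?divr_gt0 ?subr_gt0// /harmonic /= invr_gt0.
have ucv : u @ \oo --> 0.
  rewrite -(mulr0 ((T0 - b) / 3)); apply: cvgM; first exact: cvg_cst.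
  exact: cvg_harmonic.
have ub n : b + 2 * u n < T0.
  have : u n <= (T0 - b) / 3.
    by rewrite /u ger_pMr ?divr_gt0 ?subr_gt0// /harmonic /= invf_le1// ler1n.
  by move: bT; lra.
have ua n : a + 2 * u n < T0 by have := ub n; move: ab; lra.
have lhs : Rintegral leb I0 (fun t => m t * dramp (u n) (t - a)) -
    Rintegral leb I0 (fun t => m t * dramp (u n) (t - b)) @[n --> \oo] --> m a - m b.
  apply: cvgB; apply: kernel_cvg => //; first by rewrite a0 (lt_trans ab).
  by rewrite (lt_trans a0 ab).
have eqn n : Rintegral leb I0 (fun t => m t * dramp (u n) (t - a)) -
    Rintegral leb I0 (fun t => m t * dramp (u n) (t - b)) =
    Rintegral leb I0 (fun t => d t * (ramp (u n) (t - a) - ramp (u n) (t - b))).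
  pose F t := ramp (u n) (t - a) - ramp (u n) (t - b).
  pose F' t := dramp (u n) (t - a) - dramp (u n) (t - b).
  have b0 : 0 < b := lt_trans a0 ab.
  have T10 : 0 < b + 2 * u n by rewrite addr_gt0// mulr_gt0.
  (* Here 8 = 4 + 4, one share for each ramp. *)
  have FC x h : `|F (x + h) - F x - h * F' x| <= (8 / u n ^+ 2) * h ^+ 2.
    have := ramp_quadratic (x - a) h (u0 n); have := ramp_quadratic (x - b) h (u0 n).
    rewrite ![x - _ + h]addrAC => hb ha.
    have -> : F (x + h) - F x - h * F' x =
      (ramp (u n) (x + h - a) - ramp (u n) (x - a) - h * dramp (u n) (x - a)) -
      (ramp (u n) (x + h - b) - ramp (u n) (x - b) - h * dramp (u n) (x - b)).
      by rewrite /F /F'; ring.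
    apply: (le_trans (ler_normB _ _)); apply: (le_trans (lerD ha hb)).
    by rewrite le_eqVlt; apply/orP; left; apply/eqP; field; rewrite gt_eqF.
  have F'K x h : `|F' (x + h) - F' x| <= (8 / u n ^+ 2) * `|h|.
    have := dramp_lipschitz (x - a) h (u0 n); have := dramp_lipschitz (x - b) h (u0 n).
    rewrite ![x - _ + h]addrAC => hb ha.
    have -> : F' (x + h) - F' x =
      (dramp (u n) (x + h - a) - dramp (u n) (x - a)) -
      (dramp (u n) (x + h - b) - dramp (u n) (x - b)).
      by rewrite /F'; ring.
    apply: (le_trans (ler_normB _ _)); apply: (le_trans (lerD ha hb)).
    by rewrite le_eqVlt; apply/orP; left; apply/eqP; field; rewrite gt_eqF.
  have FFl t : t <= 0 -> F t = 0 /\ F' t = 0.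
    move=> t0; rewrite /F /F'.
    have [-> ->] := @ramp_left _ (u n) (t - a) (u0 n) ltac:(lra).
    have [-> ->] := @ramp_left _ (u n) (t - b) (u0 n) ltac:(lra).
    by rewrite subrr.
  have FFr t : b + 2 * u n <= t -> F t = 0 /\ F' t = 0.
    move=> t0; rewrite /F /F'.
    have [-> ->] := @ramp_right _ (u n) (t - a) (u0 n) ltac:(lra).
    have [-> ->] := @ramp_right _ (u n) (t - b) (u0 n) ltac:(lra).
    by rewrite !subrr.
  have Fl t h := (FFl t h).1. have F'l t h := (FFl t h).2.
  have Fr t h := (FFr t h).1. have F'r t h := (FFr t h).2.
  have := weak (derivable_periodize T10 (ub n) FC Fl Fr)
    (continuous_derive1_periodize T10 (ub n) FC F'K Fl Fr)
    (periodize_periodic F T10 (ub n)).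
  have -> : Rintegral leb I0 (fun t => m t * derive1 (periodize T0 F) t) =
      Rintegral leb I0 (fun t => m t * F' t).
    apply: eq_Rintegral => t /set_mem /I0P It.
    by rewrite (derive1_periodize_I0 T10 (ub n) FC Fl Fr F'l F'r).
  have -> : Rintegral leb I0 (fun t => d t * periodize T0 F t) =
      Rintegral leb I0 (fun t => d t * F t).
    apply: eq_Rintegral => t /set_mem /I0P It.
    by rewrite (periodize_I0 T10 (ub n) Fl Fr).
  move=> <-; rewrite -RintegralB//; [|exact: integrable_m_dramp..].
  by apply: eq_Rintegral => t _; rewrite /F' mulrBr.
have md : measurable_fun I0 d by exact: integrable_measurable_fun di.
have rhs : Rintegral leb I0 (fun t => d t * (ramp (u n) (t - a) - ramp (u n) (t - b)))
    @[n --> \oo] --> Rintegral leb `]a, b] d.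
  have -> : Rintegral leb `]a, b] d = Rintegral leb I0 (d \_ `]a, b]).
    rewrite -Rintegral_mkcondr; congr Rintegral.
    rewrite setIidr// => t /=; rewrite in_itv/= => /andP[t1 t2].
    by apply/I0P; rewrite (le_trans (ltW a0) (ltW t1)) (le_trans t2 (ltW bT)).
  apply: fine_cvg; rewrite fineK; last first.
    apply: integrable_fin_num => //.
    rewrite (_ : (fun x => _) = (EFin \o d) \_ `]a, b]); last by rewrite restrict_EFin.
    apply/integrable_restrict => //.
    by apply: (integrableS mI0 _ _ di); [exact: measurableI|exact: subIsetl].
  apply: (@dominated_cvg _ _ _ leb I0 mI0 _ _ (EFin \o (fun t => `|d t|))) => //.
  - move=> n; apply/measurable_EFinP; apply: measurable_funM => //.
    by apply: measurable_funB; exact: measurable_fun_ramp.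
  - move=> t It; apply: cvg_EFin; first by near=> n.
    have -> : (d \_ `]a, b]) t =
        d t * ((if 0 < t - a then 1 else 0) - (if 0 < t - b then 1 else 0)).
      rewrite patchE mem_setE in_itv/= !subr_gt0 [b < t]ltNge.
      case: (ltP a t) => h1; case: (leP t b) => h2 /=; rewrite ?subr0 ?subrr ?mulr1 ?mulr0//.
      by exfalso; move: ab h1 h2; lra.
    apply: cvgM; first exact: cvg_cst.
    by apply: cvgB; exact: ramp_cvg.
  - exact: integrable_normr.
  - move=> n t It /=; rewrite lee_fin normrM ler_piMr//.
    have /andP[] := ramp_bounds (t - a) (u0 n).
    have /andP[] := ramp_bounds (t - b) (u0 n).
    by rewrite ler_norml => *; apply/andP; split; lra.
have eqf : (fun n => Rintegral leb I0 (fun t => m t * dramp (u n) (t - a)) -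
    Rintegral leb I0 (fun t => m t * dramp (u n) (t - b))) =
    (fun n => Rintegral leb I0 (fun t => d t * (ramp (u n) (t - a) - ramp (u n) (t - b)))).
  exact/funext.
rewrite eqf in lhs.
exact: (cvg_unique _ lhs rhs).
Unshelve. all: by end_near. Qed.

Lemma ae_lebesgue_pt : {ae leb, forall t, lebesgue_pt (m \_ I0) t}.
Proof.
apply: lebesgue_differentiation; apply: integrable_locally => //.
exact: measurable_I0.
Qed.

End WeakDerivative.

(** * Chain rule for the logarithm of a primitive *)

Section LogBounds.
Variable R : realType.

Lemma ln_le_subr1 (x : R) : 0 < x -> ln x <= x - 1.
Proof. by move=> x0; rewrite -[x in ln x](subrKC 1) le_ln1Dx//; lra. Qed.

Lemma ln_lipschitz (e p q : R) : 0 < e -> e <= p -> e <= q ->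
  `|ln p - ln q| <= `|p - q| / e.
Proof.
move=> e0 ep eq; have p0 : 0 < p by exact: lt_le_trans ep.
have q0 : 0 < q by exact: lt_le_trans eq.
wlog pq : p q ep eq p0 q0 / q <= p.
  by move=> wl; have [h|/ltW h] := leP q p; [exact: wl|rewrite distrC [`|p - q|]distrC; exact: wl].
rewrite !ger0_norm ?subr_ge0 ?ler_ln ?posrE//.
rewrite -ln_div ?posrE//.
apply: (le_trans (ln_le_subr1 (divr_gt0 p0 q0))).
have -> : p / q - 1 = (p - q) / q by rewrite mulrBl divff// gt_eqF.
by rewrite ler_wpM2l ?subr_ge0// lef_pV2.
Qed.

(** The primitive of [ln]. *)
Definition entropy (v : R) : R := v * ln v - v.

(** Two uses of [ln u <= u - 1]: at [p / q] it shows that the remainder is nonnegative (convexity),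
    at [q / p] it gives the upper bound. *)
Lemma entropy_remainder (p q : R) : 0 < p -> 0 < q ->
  `|entropy q - entropy p - ln p * (q - p)| <= (q - p) ^+ 2 / p.
Proof.
move=> p0 q0; rewrite /entropy.
have -> : q * ln q - q - (p * ln p - p) - ln p * (q - p) = q * (ln q - ln p) - (q - p) by ring.
have h1 : ln q - ln p <= q / p - 1 by rewrite -ln_div ?posrE//; exact/ln_le_subr1/divr_gt0.
have h2 : ln p - ln q <= p / q - 1 by rewrite -ln_div ?posrE//; exact/ln_le_subr1/divr_gt0.
have k1 : q * (ln q - ln p) <= q * (q / p - 1) by rewrite ler_pM2l.
have k2 : q * (ln p - ln q) <= q * (p / q - 1) by rewrite ler_pM2l.
rewrite ger0_norm.
  have -> : (q - p) ^+ 2 / p = q * (q / p - 1) - (q - p) by field; rewrite gt_eqF.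
  by rewrite lerD2r.
have k3 : q * (p / q - 1) = p - q by field; rewrite gt_eqF.
by move: k2; rewrite k3; lra.
Qed.

End LogBounds.

Section Primitive.
Variables (R : realType) (e : R -> R).
Notation leb := (@leb R).
Hypothesis ei : leb.-integrable setT (EFin \o e).

Lemma integrable_sub (A : set (measurableTypeR R)) : measurable A ->
  leb.-integrable A (EFin \o e).
Proof. by move=> mA; apply: (integrableS _ _ _ ei). Qed.

Definition prim (y : R) : R := Rintegral leb `[0, y] e.

Lemma prim0 : prim 0 = 0.
Proof. by rewrite /prim set_itv1 Rintegral_set1. Qed.

Lemma primB (u v : R) : 0 <= u -> u <= v ->
  prim v - prim u = Rintegral leb `]u, v] e.
Proof.
move=> u0 uv; rewrite /prim Rintegral_itvB ?bnd_simp//.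
by apply: integrable_sub; exact: measurable_itv.
Qed.

Lemma prim_uniform (eta : R) : 0 < eta -> exists2 del : R, 0 < del &
  forall u v, 0 <= u -> u <= v -> v - u < del -> `|prim v - prim u| <= eta.
Proof.
move=> eta0; have [del [del0 H]] := integral_normr_continuous ei eta0.
exists del => // u v u0 uv uvd; rewrite primB//.
have mA : measurable (`]u, v]%classic : set (measurableTypeR R)) by exact: measurable_itv.
apply: (le_trans (le_normr_Rintegral mA (integrable_sub mA))).
have lt : (@lebesgue_measure R `]u, v]%classic < del%:E)%E.
  rewrite lebesgue_measure_itv/= lte_fin.
  by case: ifP => _; rewrite -?EFinD lte_fin.
exact/ltW/(H _ mA lt).
Qed.

Lemma prim_uniform_dist (eta : R) : 0 < eta -> exists2 del : R, 0 < del &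
  forall u v, 0 <= u -> 0 <= v -> `|v - u| < del -> `|prim v - prim u| <= eta.
Proof.
move=> /prim_uniform[del del0 H]; exists del => // u v u0 v0.
have [uv|/ltW vu] := leP u v; first by rewrite ger0_norm ?subr_ge0//; exact: H.
by rewrite distrC [`|prim _ - _|]distrC ger0_norm ?subr_ge0//; exact: H.
Qed.

Lemma measurable_prim (T0 : R) : 0 <= T0 -> measurable_fun (@I0 R T0) prim.
Proof.
move=> T0_ge0; apply: subspace_continuous_measurable_fun; first exact: measurable_I0.
apply: parameterized_integral_continuous => //.
by apply: integrable_sub; exact: measurable_itv.
Qed.

Section ChainRule.
Variables (T0 c del : R).
Hypotheses (T0_gt0 : 0 < T0) (del0 : 0 < del).
Hypothesis x_ge0 : forall t, 0 <= t <= T0 -> 0 <= c - prim t.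
Let x t := c - prim t + del.
Let g t := e t * ln (x t).
Let nrm y := Rintegral leb `[0, y] (fun t => `|e t|).

Let x_ge t : 0 <= t <= T0 -> del <= x t.
Proof. by move=> /x_ge0; rewrite /x lerDr. Qed.

Let mI0 := @measurable_I0_leb R T0.

Let measurable_x : measurable_fun (@I0 R T0) x.
Proof.
apply: measurable_funD => //; apply: measurable_funB => //.
by apply: measurable_prim; exact: ltW.
Qed.

(** [ln (x t)] is compared with [ln del]: above [del] the logarithm is Lipschitz with constant
    [1 / del], and [x t - del] is controlled by [c] and the total integral of [|e|]. *)
Let x_bounded t : 0 <= t <= T0 -> `|ln (x t)| <=
  `|ln del| + (`|c| + Rintegral leb setT (fun t => `|e t|)) / del.
Proof.
move=> tI; have /andP[t0 tT] := tI.
have xt := x_ge tI.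
have -> : ln (x t) = ln del + (ln (x t) - ln del) by rewrite subrKC.
apply: (le_trans (ler_normD _ _)); rewrite lerD2l.
apply: (le_trans (ln_lipschitz del0 xt (lexx _))).
rewrite ler_pM2r ?invr_gt0// /x addrK.
apply: (le_trans (ler_normB _ _)); rewrite lerD2l.
have mA : measurable (`[0, t]%classic : set (measurableTypeR R)) by exact: measurable_itv.
apply: (le_trans (le_normr_Rintegral mA (integrable_sub mA))).
rewrite /Rintegral fine_le//.
- by apply: integrable_fin_num => //; exact/integrable_normr/integrable_sub.
- by apply: integrable_fin_num => //; exact: integrable_normr.
- apply: ge0_subset_integral => //.
  by apply: (measurable_int leb); exact: integrable_normr.
Qed.

Lemma integrable_chain : leb.-integrable (@I0 R T0) (EFin \o g).
Proof.
apply: (integrableM_bounded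
  (C := `|ln del| + (`|c| + Rintegral leb setT (fun t => `|e t|)) / del)) => //.
- exact: integrable_sub.
- exact: (measurableT_comp (@measurable_ln R) measurable_x).
Qed.

Let chain y := Rintegral leb `[0, y] g.

Let chainB u v : 0 <= u -> u <= v -> v <= T0 ->
  chain v - chain u = Rintegral leb `]u, v] g.
Proof.
move=> u0 uv vT; rewrite /chain Rintegral_itvB ?bnd_simp//.
apply: (integrableS mI0 _ _ integrable_chain); first exact: measurable_itv.
by move=> t /=; rewrite in_itv/= => /andP[t0 tv]; apply/I0P; rewrite t0 (le_trans tv).
Qed.

Let nrmB u v : 0 <= u -> u <= v ->
  nrm v - nrm u = Rintegral leb `]u, v] (fun t => `|e t|).
Proof.
move=> u0 uv; rewrite /nrm Rintegral_itvB ?bnd_simp//.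
apply: integrable_normr; first exact: measurable_itv.
by apply: integrable_sub; exact: measurable_itv.
Qed.

(* The increment of [theta] over [u, v] is at most a small multiple of the integral of
   |e| over ]u, v]; summing over a fine partition shows theta T0 = theta 0. *)
Let theta y := entropy (x y) + chain y.

Let theta_increment (eta u v : R) : 0 <= u -> u <= v -> v <= T0 ->
  (forall s, u <= s -> s <= v -> `|prim s - prim u| <= eta) ->
  `|theta v - theta u| <= 2 * eta / del * (nrm v - nrm u).
Proof.
move=> u0 uv vT osc; rewrite nrmB//.
have mA : measurable (`]u, v]%classic : set (measurableTypeR R)) by exact: measurable_itv.
have uI : 0 <= u <= T0 by rewrite u0 (le_trans uv).
have vI : 0 <= v <= T0 by rewrite (le_trans u0 uv).
have xu := x_ge uI; have xv := x_ge vI.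
have xu0 : 0 < x u by exact: lt_le_trans xu.
have xv0 : 0 < x v by exact: lt_le_trans xv.
have eA := integrable_sub mA.
have gA : leb.-integrable `]u, v] (EFin \o g).
  apply: (integrableS mI0 _ _ integrable_chain); first exact: measurable_itv.
  move=> t /=; rewrite in_itv/= => /andP[t0 tv]; apply/I0P.
  by rewrite (le_trans u0 (ltW t0)) (le_trans tv).
set N := Rintegral leb `]u, v] (fun t => `|e t|).
have N0 : 0 <= N by apply: Rintegral_ge0.
have xvu : x v - x u = - Rintegral leb `]u, v] e.
  by rewrite -primB// /x; ring.
have dN : `|x v - x u| <= N.
  by rewrite xvu normrN; exact: le_normr_Rintegral.
have de : `|x v - x u| <= eta.
  have := osc v uv (lexx _); rewrite distrC /x; apply: le_trans.
  by rewrite (_ : c - prim v + del - (c - prim u + del) = prim u - prim v)//; ring.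
(* Freezing the logarithm at [u] leaves a second-order remainder of [entropy] and the integral of
   [e] against the variation of [ln x]. Each is at most [eta / del * N]. *)
have -> : theta v - theta u =
    (entropy (x v) - entropy (x u) - ln (x u) * (x v - x u)) +
    Rintegral leb `]u, v] (fun s => g s - ln (x u) * e s).
  rewrite RintegralB//; last exact: integrable_cstM.
  by rewrite RintegralZl// xvu -chainB// /theta; ring.
apply: (le_trans (ler_normD _ _)).
have -> : 2 * eta / del * N = eta / del * N + eta / del * N by ring.
apply: lerD.
  apply: (le_trans (entropy_remainder xu0 xv0)).
  rewrite -real_normK ?num_real// expr2 mulrAC ler_pM//.
    by rewrite divr_ge0// ltW.
  by apply: ler_pM => //; rewrite ?invr_ge0 ?(ltW xu0)// lef_pV2.
have gB : leb.-integrable `]u, v] (EFin \o (fun s => g s - ln (x u) * e s)).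
  by apply: integrableB_real => //; exact: integrable_cstM.
apply: (le_trans (le_normr_Rintegral mA gB)).
rewrite -RintegralZl//; last exact: integrable_normr.
apply: le_Rintegral => //.
- exact: integrable_normr.
- by apply: integrable_cstM => //; exact: integrable_normr.
- move=> s /=; rewrite in_itv/= => /andP[us sv].
  rewrite /g [ln (x u) * _]mulrC -mulrBr normrM mulrC ler_wpM2r//.
  have sI : 0 <= s <= T0 by rewrite (le_trans u0 (ltW us)) (le_trans sv).
  apply: (le_trans (ln_lipschitz del0 (x_ge sI) xu)).
  rewrite ler_pM2r ?invr_gt0//.
  have := osc s (ltW us) sv; rewrite distrC; apply: le_trans.
  by rewrite /x (_ : c - prim s + del - (c - prim u + del) = prim u - prim s)//; ring.
Qed.

Let theta_total (eta : R) : 0 < eta ->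
  `|theta T0 - theta 0| <= 2 * eta / del * (nrm T0 - nrm 0).
Proof.
move=> eta0; have [dl dl0 H] := prim_uniform eta0.
pose n := (Num.truncn (T0 / dl)).+1.
have n0 : 0 < n%:R :> R by rewrite ltr0n.
have small : T0 / n%:R < dl.
  rewrite ltr_pdivrMr// mulrC -ltr_pdivrMr//.
  exact: truncnS_gt.
suff step i : (i <= n)%N -> `|theta (i%:R * (T0 / n%:R)) - theta 0| <=
    2 * eta / del * (nrm (i%:R * (T0 / n%:R)) - nrm 0).
  have := step n (leqnn _); rewrite (_ : n%:R * (T0 / n%:R) = T0)//.
  by field; rewrite gt_eqF.
elim: i => [_|i IH ilt]; first by rewrite !mul0r !subrr normr0 mulr0.
have := IH (ltnW ilt).
set u := i%:R * (T0 / n%:R); set v := i.+1%:R * (T0 / n%:R) => IHu.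
have vu : v = u + T0 / n%:R by rewrite /v /u -natr1 mulrDl mul1r.
have Tn : 0 < T0 / n%:R by rewrite divr_gt0.
have u0 : 0 <= u by rewrite mulr_ge0// ltW.
have uv : u <= v by rewrite vu lerDl ltW.
have vT : v <= T0.
  rewrite /v mulrCA ler_piMr// ?(ltW T0_gt0)// ler_pdivrMr// mul1r ler_nat//.
rewrite -(subrKA (theta u)) -[nrm v - nrm 0](subrKA (nrm u)) mulrDr.
apply: (le_trans (ler_normD _ _)); apply: lerD => //.
apply: theta_increment => // s us sv; apply: H => //.
by apply: le_lt_trans small; rewrite lerBlDl -vu.
Qed.

Lemma chain_rule : Rintegral leb (@I0 R T0) g = entropy (x 0) - entropy (x T0).
Proof.
suff : theta T0 - theta 0 = 0.
  have c0 : chain 0 = 0 by rewrite /chain set_itv1 Rintegral_set1.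
  rewrite /theta c0 addr0 => /eqP; rewrite subr_eq0 => /eqP <-.
  by rewrite [RHS]addrAC subrr add0r.
apply/eqP; rewrite -normr_eq0 eq_le normr_ge0 andbT.
apply/ler_addgt0Pr => z z0; rewrite add0r.
pose K := 2 / del * (nrm T0 - nrm 0).
have K0 : 0 <= K.
  by rewrite /K mulr_ge0 ?divr_ge0 ?(ltW del0)// nrmB ?(ltW T0_gt0)//; exact: Rintegral_ge0.
have h0 : 0 < z / (K + 1) by rewrite divr_gt0// ltr_wpDl.
apply: (le_trans (theta_total h0)).
have -> : 2 * (z / (K + 1)) / del * (nrm T0 - nrm 0) = z * (K / (K + 1)).
  by rewrite /K; ring.
by rewrite ler_piMr ?(ltW z0)// ler_pdivrMr ?ltr_wpDl// mul1r lerDl.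
Qed.

End ChainRule.
End Primitive.

(** * Almost everywhere statements and interior maxima *)

Section AlmostEverywhere.
Variable R : realType.
Notation leb := (@leb R).

Lemma ae_weaken (P Q : R -> Prop) : (forall t, P t -> Q t) ->
  {ae leb, forall t, P t} -> {ae leb, forall t, Q t}.
Proof.
move=> PQ [N [mN N0 PN]]; exists N; split => // t /= nQ; apply: PN => /= Pt.
exact/nQ/PQ.
Qed.

Lemma ae_and (P Q : R -> Prop) : {ae leb, forall t, P t} ->
  {ae leb, forall t, Q t} -> {ae leb, forall t, P t /\ Q t}.
Proof. exact: (@filterI _ _ (ae_filter_ringOfSetsType (@lebesgue_measure R))). Qed.

Lemma ae_forall (I : finType) (P : I -> R -> Prop) :
  (forall i, {ae leb, forall t, P i t}) -> {ae leb, forall t, forall i, P i t}.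
Proof.
exact: (@filter_forall _ _ _ _ (ae_filter_ringOfSetsType (@lebesgue_measure R))).
Qed.

Lemma ae_dense (P : R -> Prop) (u v : R) : {ae leb, forall t, P t} -> u < v ->
  exists2 t, u < t < v & P t.
Proof.
move=> [N [mN N0 PN]] uv; apply: contrapT => nex.
have sub : `]u, v[%classic `<=` N.
  move=> t /=; rewrite in_itv/= => tuv; apply: PN => /= Pt.
  by apply: nex; exists t.
have luv : lebesgue_measure `]u, v[%classic = (v - u)%:E :> \bar R.
  by rewrite lebesgue_measure_itv/= lte_fin uv.
have muv : measurable (`]u, v[%classic : set (measurableTypeR R)) by exact: measurable_itv.
have : ((v - u)%:E <= leb N)%E.
  by rewrite -luv; exact: (le_measure leb (mem_set muv) (mem_set mN) sub).
by rewrite N0 lee_fin subr_le0 leNgt uv.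
Qed.

Lemma ae_neq (a : R) : {ae leb, forall t, t <> a}.
Proof.
exists [set a]; split; [exact: measurable_set1|exact: lebesgue_measure_set1|].
by move=> t /= /contrapT.
Qed.

(** Fermat's rule, with differentiability at the maximum only. The difference quotients at [h] and
    [- h] have opposite signs, so if the derivative [l] were nonzero, one of them would stay at
    distance at least [|l|] from it; [h] is small enough for both points to remain in [0, T0]. *)
Lemma derive1_max_eq0 (F : R -> R) (t T0 : R) : 0 < t < T0 -> derivable F t 1 ->
  (forall s, 0 <= s <= T0 -> F s <= F t) -> derive1 F t = 0.
Proof.
move=> /andP[t0 tT] dF Fmax; set l := derive1 F t.
have cv : h^-1 *: (F (h *: (1 : R) + t) - F t) @[h --> 0^'] --> l.
  by rewrite /l derive1E; exact: dF.
apply/eqP; apply: contraT => l0.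
move/cvgrPdist_lt : cv => /(_ `|l|); rewrite normr_gt0 => /(_ l0) [r r0 Hr].
pose h := Num.min (r / 2) (Num.min (t / 2) ((T0 - t) / 2)).
have h0 : 0 < h by rewrite !lt_min !divr_gt0// subr_gt0.
have hr : h < r by rewrite gt_min ltr_pdivrMr// ltr_pMr// ltr1n.
have ht : h <= t.
  by rewrite ge_min; apply/orP; right; rewrite ge_min; apply/orP; left; lra.
have hT : h <= T0 - t.
  by rewrite ge_min; apply/orP; right; rewrite ge_min; apply/orP; right; move: tT; lra.
have key k : k != 0 -> `|k| = h -> `|l - k^-1 * (F (k + t) - F t)| < `|l|.
  move=> k0 kh; have := Hr k; rewrite /GRing.scale /= mulr1; apply => //.
  by rewrite /ball_ /= sub0r normrN kh.
have Fle k : `|k| = h -> F (k + t) - F t <= 0.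
  move=> kh; rewrite subr_le0; apply: Fmax.
  have : `|k| <= h by rewrite kh.
  rewrite ler_norml => /andP[k1 k2].
  by apply/andP; split; [move: ht; lra|move: hT; lra].
have [l1|l1|l1] := ltgtP l 0; last by move: l0; rewrite l1 eqxx.
- have nh : `|- h| = h by rewrite normrN gtr0_norm.
  have := key (- h) _ nh; rewrite oppr_eq0 gt_eqF// => /(_ isT).
  have q0 : 0 <= (- h)^-1 * (F (- h + t) - F t).
    by rewrite invrN mulNr -mulrN mulr_ge0 ?invr_ge0 ?(ltW h0)// oppr_ge0 Fle.
  rewrite !ltr0_norm//; last by move: q0 l1; lra.
  by move: q0; lra.
- have ph : `|h| = h by rewrite gtr0_norm.
  have := key h _ ph; rewrite gt_eqF// => /(_ isT).
  have q0 : h^-1 * (F (h + t) - F t) <= 0.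
    by rewrite mulr_ge0_le0 ?invr_ge0 ?(ltW h0)// Fle.
  rewrite !gtr0_norm//; last by move: q0 l1; lra.
  by move: q0; lra.
Qed.

End AlmostEverywhere.

(** * Densities on the circle with an integrable weak derivative *)

Section CircleDensity.
Variables (R : realType) (T0 : R).
Hypothesis T0_gt0 : 0 < T0.
Notation leb := (@leb R).
Notation I0 := (@I0 R T0).
Variables (m d : R -> R).
Hypothesis mi : leb.-integrable I0 (EFin \o m).
Hypothesis di : leb.-integrable I0 (EFin \o d).
Hypothesis weak : forall f : R -> R, (forall t, derivable f t 1) ->
  continuous (derive1 f) -> (forall t, f (t + T0) = f t) ->
  Rintegral leb I0 (fun t => m t * derive1 f t) =
  Rintegral leb I0 (fun t => d t * f t).
Hypothesis m_ge0 : forall t, 0 <= t <= T0 -> 0 <= m t.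

Let mI0 := @measurable_I0_leb R T0.
(** Extended by zero, because primitives are built from a function integrable on the whole line. *)
Let e := d \_ I0.

Let ei : leb.-integrable setT (EFin \o e).
Proof.
rewrite /e; have -> : EFin \o d \_ I0 = (EFin \o d) \_ I0 by rewrite restrict_EFin.
by apply/(integrable_restrict leb) => //; rewrite setTI.
Qed.

Let eE (A : set R) : A `<=` I0 -> Rintegral leb A e = Rintegral leb A d.
Proof.
move=> AI; apply: eq_Rintegral => t /set_mem /AI It.
by rewrite mem_set.
Qed.

(** The test function is the constant 1. This gives the primitive equal values at 0 and [T0], so the
    boundary entropies in the chain rule cancel. *)
Lemma integral_divergence0 : Rintegral leb I0 d = 0.
Proof.
have d1 : derive1 (cst 1 : R -> R) = cst 0.
  by apply/funext => t; rewrite derive1_cst.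
have := weak (f := (cst 1 : R -> R)); rewrite d1 => h.
have -> : Rintegral leb I0 d = Rintegral leb I0 (fun t => d t * cst 1 t).
  by apply: eq_Rintegral => t _; rewrite mulr1.
rewrite -h//; last by move=> t; exact: cvg_cst.
have -> : Rintegral leb I0 (fun t => m t * cst 0 t) = Rintegral leb I0 (fun=> 0).
  by apply: eq_Rintegral => t _; rewrite mulr0.
by rewrite Rintegral_cst// mul0r.
Qed.

Let prim_T0 : prim e T0 = 0.
Proof. by rewrite /prim -/I0 eE// integral_divergence0. Qed.

(** One Lebesgue point [t0] fixes the constant, and [weak_increment] carries it to all the others.
    If there is none in the open interval, the claim is vacuous and [c = 0] serves. *)
Lemma good_prim : exists c : R,
  (forall t, 0 < t < T0 -> lebesgue_pt (m \_ I0) t -> m t = c - prim e t).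
Proof.
have [[t0 [t0I t0L]]|nex] := pselect (exists t, 0 < t < T0 /\ lebesgue_pt (m \_ I0) t); last first.
  by exists 0 => t tI tL; exfalso; apply: nex; exists t.
have incr a b : 0 < a -> a < b -> b < T0 -> lebesgue_pt (m \_ I0) a ->
    lebesgue_pt (m \_ I0) b -> m a - m b = prim e b - prim e a.
  move=> a0 ab bT la lb; rewrite (weak_increment T0_gt0 mi di weak)// primB// ?ltW// eE//.
  move=> t /=; rewrite in_itv/= => /andP[at_ tb]; apply/I0P.
  by rewrite (ltW (lt_trans a0 at_)) (le_trans tb (ltW bT)).
exists (m t0 + prim e t0) => t /andP[tp tT] tL; move/andP: t0I => [t0p t0T].
have [tt|tt|->] := ltgtP t t0; last by rewrite addrK.
- by have := incr _ _ tp tt t0T tL t0L; lra.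
- by have := incr _ _ t0p tt tT t0L tL; lra.
Qed.

Let c := sval (cid good_prim).
Let cP := svalP (cid good_prim).

Let ae_prim : {ae leb, forall t, I0 t -> m t = c - prim e t}.
Proof.
have := ae_and (ae_lebesgue_pt mi) (ae_and (ae_neq T0) (ae_neq 0)).
apply: ae_weaken => t [tL [tT t0]] /I0P /andP[h0 hT].
by apply: cP => //; rewrite !lt_neqAle h0 hT !andbT; apply/andP; split; apply/eqP => // /esym.
Qed.

(** Almost everywhere this is the sign of [m]; the uniform continuity of the primitive extends it to
    every point, as the chain rule requires. A negative value at [t] would persist up to half its
    size nearby, where some point [s] satisfies [m s = c - prim e s]. *)
Let x_ge0 t : 0 <= t <= T0 -> 0 <= c - prim e t.
Proof.
move=> /andP[t0 tT]; rewrite leNgt; apply/negP => neg.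
have eta0 : 0 < - (c - prim e t) / 2 by rewrite divr_gt0// oppr_gt0.
have [dl dl0 H] := prim_uniform_dist ei eta0.
have [u [v [u0 uv vT uvt]]] : exists u v : R, [/\ 0 <= u, u < v, v <= T0 &
    forall s, u < s < v -> `|t - s| < dl].
  (* The truncation keeps the interval nonempty inside [0, T0] even when [t] is an endpoint. *)
  exists (Num.max 0 (t - dl / 2)), (Num.min T0 (t + dl / 2)); split.
  - by rewrite le_max lexx.
  - by rewrite gt_max !lt_min; apply/andP; split; apply/andP; split; move: t0 tT dl0 T0_gt0; lra.
  - by rewrite ge_min lexx.
  - move=> s; rewrite gt_max lt_min => /andP[/andP[_ s1] /andP[_ s2]].
    by rewrite ltr_norml; apply/andP; split; move: dl0; lra.
have [s /andP[us sv] Ps] := ae_dense ae_prim uv.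
have s0 : 0 <= s by rewrite (le_trans u0)// ltW.
have sT : s <= T0 by rewrite (le_trans (ltW sv)).
have Is : I0 s by apply/I0P; rewrite s0 sT.
have ms : 0 <= m s by apply: m_ge0; rewrite s0 sT.
have := H s t s0 t0 (uvt s _); rewrite us sv => /(_ isT).
move: ms; rewrite (Ps Is) ler_norml => ms /andP[_]; move: neg; lra.
Qed.

Lemma ae_zero_divergence : {ae leb, forall t, I0 t -> m t = 0 -> d t = 0}.
Proof.
have eL : {ae leb, forall t, lebesgue_pt e t}.
  by apply: lebesgue_differentiation; exact: integrable_locally.
have := ae_and ae_prim (ae_and eL (ae_and (ae_neq T0) (ae_neq 0))).
apply: ae_weaken => t [tx [tL [tT t0]]] It mt0.
have tI : 0 < t < T0.
  move/I0P : (It) => /andP[h0 hT].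
  by rewrite !lt_neqAle h0 hT !andbT; apply/andP; split; apply/eqP => // /esym.
have /andP[tp tlT] := tI.
have intT : leb.-integrable [set` Interval (BLeft 0) (BRight T0)] (EFin \o e).
  by apply: integrable_sub => //; exact: measurable_itv.
have [dP PE] := FTC1_lebesgue_pt tlT intT tp tL.
have : derive1 (prim e) t = 0.
  apply: (derive1_max_eq0 tI) => // s sI.
  by have := x_ge0 sI; move: (tx It); rewrite mt0; lra.
rewrite /prim PE /e patchE mem_set//.
Qed.

Lemma integral_log_divergence (del : R) : 0 < del ->
  Rintegral leb I0 (fun t => d t * ln (m t + del)) = 0.
Proof.
move=> del0.
have := chain_rule ei T0_gt0 del0 x_ge0; rewrite prim_T0 prim0 subrr => <-.
rewrite /Rintegral; congr fine; apply: ae_eq_integral => //.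
- apply/measurable_EFinP; apply: measurable_funM.
    exact: (integrable_measurable_fun di).
  apply: (measurableT_comp (@measurable_ln R)).
  apply: measurable_funD => //; exact: (integrable_measurable_fun mi).
- exact: (measurable_int leb (integrable_chain ei T0_gt0 del0 x_ge0)).
- have := ae_prim; apply: ae_weaken => t tx It.
  by rewrite (tx It) /e patchE mem_set.
Qed.

End CircleDensity.

(** * Accompanying distribution *)

Section InvariantDistribution.
Variables (R : realFieldType) (V : finType) (E : rel V) (q : V -> V -> R).
Hypothesis q_ge0 : forall y z, 0 <= q y z.
Hypothesis q_gt0 : forall y z, E y z -> 0 < q y z.
Hypothesis E_connected : forall y z, connect E y z.

Definition balanced (p : V -> R) :=
  forall z, \sum_y p y * q y z = p z * \sum_y q z y.

(** Zeros spread against the direction of the edges: if [p x = 0], the balance at [x] makes the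
    total inflow zero, hence [p y = 0] for every edge from [y] to [x]. Strong connectivity then
    reaches all vertices. *)
Lemma balanced_eq0 (p : V -> R) (z0 : V) : (forall y, 0 <= p y) -> balanced p ->
  p z0 = 0 -> forall y, p y = 0.
Proof.
move=> p0 bp pz0 y; have /connectP[s] := E_connected y z0.
elim: s y => [y _ /= <-//|x s IH y /= /andP[Eyx pxs] zl].
have px : p x = 0 by exact: IH.
have := bp x; rewrite px mul0r => /eqP.
rewrite psumr_eq0; last by move=> i _; rewrite mulr_ge0.
move=> /allP /(_ y (mem_index_enum _)) /=; rewrite mulf_eq0 => /orP[/eqP//|].
by rewrite gt_eqF// q_gt0.
Qed.

Lemma balanced_gt0 (p : V -> R) : (forall y, 0 <= p y) -> balanced p ->
  \sum_y p y = 1 -> forall y, 0 < p y.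
Proof.
move=> p0 bp p1 y; rewrite lt_neqAle p0 andbT eq_sym; apply/eqP => py.
move: p1; rewrite big1; last by move=> x _; exact: balanced_eq0 py x.
by move/eqP; rewrite eq_sym oner_eq0.
Qed.

(** With [k] the smallest ratio [v i / p i], the vector [v - k p] is balanced, nonnegative and zero
    at the minimiser, hence zero everywhere. So [v] is a multiple of [p], and its sum forces
    [k = 0]. *)
Lemma balanced_sum0 (p v : V -> R) : (forall y, 0 <= p y) -> balanced p ->
  \sum_y p y = 1 -> balanced v -> \sum_y v y = 0 -> forall y, v y = 0.
Proof.
move=> p0 bp p1 bv v0 y.
have pp := balanced_gt0 p0 bp p1.
pose c := [arg min_(i < y) (v i / p i)]%O.
have cP i : v c / p c <= v i / p i by rewrite /c; case: arg_minP => // j _; exact.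
pose k := v c / p c; pose u i := v i - k * p i.
have u0 i : 0 <= u i by rewrite /u subr_ge0 -ler_pdivlMr.
have bu : balanced u.
  move=> z; rewrite /u.
  under eq_bigr do rewrite mulrBl -mulrA.
  by rewrite sumrB -mulr_sumr bp bv mulrBl mulrA.
have uc : u c = 0 by rewrite /u /k divfK ?subrr// gt_eqF.
have uz := balanced_eq0 u0 bu uc.
have vE i : v i = k * p i by apply/eqP; rewrite -subr_eq0; apply/eqP/uz.
have : \sum_i v i = k.
  by under eq_bigr do rewrite vE; rewrite -mulr_sumr p1 mulr1.
by rewrite v0 vE => <-; rewrite mul0r.
Qed.

(* Generator plus the all-ones matrix: an invariant distribution p solves
   p *m gen_mx = const_mx 1, and gen_mx is invertible by uniqueness, so Cramer's rule
   expresses p through the rates and makes it measurable in time. *)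
Definition gen_mx : 'M[R]_#|V| := \matrix_(i, j)
  (q (enum_val i) (enum_val j) - (if i == j then \sum_y q (enum_val i) y else 0) + 1).

Lemma sum_enum_val (f : V -> R) : \sum_(i < #|V|) f (enum_val i) = \sum_y f y.
Proof. by rewrite -big_enum_val; apply: eq_bigl => y; rewrite inE. Qed.

Lemma mul_gen_mx (p : V -> R) j :
  ((\row_i p (enum_val i)) *m gen_mx) ord0 j =
  \sum_y p y * q y (enum_val j) - p (enum_val j) * \sum_y q (enum_val j) y + \sum_y p y.
Proof.
rewrite mxE; under eq_bigr do rewrite !mxE mulrDr mulr1 mulrBr.
rewrite big_split/= sumrB (sum_enum_val p); congr (_ - _ + _).
  exact: (sum_enum_val (fun y => p y * q y (enum_val j))).
rewrite (bigD1 j)//= eqxx [X in _ + X]big1 ?addr0// => i ij.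
by rewrite (negbTE ij) mulr0.
Qed.

Lemma det_gen_mx (p : V -> R) : (forall y, 0 <= p y) -> balanced p ->
  \sum_y p y = 1 -> \det gen_mx != 0.
Proof.
move=> p0 bp p1; apply/det0P => -[v vn0 vM].
pose f y := v ord0 (enum_rank y).
have vf : v = \row_i f (enum_val i).
  by apply/rowP => i; rewrite mxE /f enum_valK.
have eqj j : \sum_y f y * q y j - f j * \sum_y q j y + \sum_y f y = 0.
  have := mul_gen_mx f (enum_rank j); rewrite -vf vM mxE enum_rankK => <-//.
have V0 : (0 < #|V|)%N.
  rewrite lt0n; apply/eqP => /card0_eq V0; move: p1.
  by rewrite big_pred0 => [/eqP|y]; [rewrite eq_sym oner_eq0|have := V0 y; rewrite inE].
(* Summing the equations over [j] cancels the generator part, since total inflow equals total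
   outflow, and leaves [#|V|] times the sum of [f]. *)
have f0 : \sum_y f y = 0.
  have : \sum_j (\sum_y f y * q y j - f j * \sum_y q j y + \sum_y f y) = 0.
    by rewrite big1.
  rewrite big_split sumrB/= exchange_big/=.
  under eq_bigr do rewrite -mulr_sumr.
  rewrite subrr add0r sumr_const => /eqP; rewrite mulrn_eq0 => /orP[/eqP h|/eqP//].
  by move: V0; rewrite (_ : #|V| = #|xpredT : pred V|) ?h//; exact: eq_card.
have bf : balanced f.
  by move=> z; apply/eqP; rewrite -subr_eq0; have := eqj z; rewrite f0 addr0 => ->.
move/eqP: vn0; apply; apply/rowP => i; rewrite vf !mxE.
exact: (balanced_sum0 p0 bp p1 bf f0).
Qed.

Lemma balanced_adj (p : V -> R) y : (forall y, 0 <= p y) -> balanced p ->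
  \sum_y p y = 1 ->
  p y = (\sum_i \adj gen_mx i (enum_rank y)) * (\det gen_mx)^-1.
Proof.
move=> p0 bp p1; have d0 := det_gen_mx p0 bp p1.
have pM : (\row_i p (enum_val i)) *m gen_mx = const_mx 1.
  apply/rowP => j; have := mul_gen_mx p j; rewrite bp subrr add0r p1 => ->.
  by rewrite mxE.
have : (\row_i p (enum_val i)) *m gen_mx *m \adj gen_mx = const_mx 1 *m \adj gen_mx.
  by rewrite pM.
rewrite -mulmxA mul_mx_adj mul_mx_scalar => /rowP /(_ (enum_rank y)).
rewrite !mxE enum_rankK; under eq_bigr do rewrite mxE mul1r.
by move=> <-; rewrite mulrC mulKf.
Qed.

End InvariantDistribution.

(** * Measurability and uniform positivity in time *)

Section MeasurableInvariant.
Variables (R : realType) (V : finType).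

(** Writing [1 / f] as [f * expR (- ln (f ^+ 2))] reduces the claim to [expR] and [ln]; the square
    takes care of the unknown sign of [f], here a determinant. *)
Lemma measurable_invr (D : set R) (f : R -> R) : (forall t, D t -> f t != 0) ->
  measurable_fun D f -> measurable_fun D (fun t => (f t)^-1).
Proof.
move=> f0 mf.
apply: (eq_measurable_fun (fun t => f t * expR (- ln (f t ^+ 2)))).
  move=> t /set_mem /f0 ft; have f2 : 0 < f t ^+ 2 by rewrite exprn_even_gt0.
  by rewrite -lnV ?posrE// lnK ?posrE ?invr_gt0//; field.
apply: measurable_funM => //; apply: (measurableT_comp (@measurable_expR R)).
apply: measurable_funN; apply: (measurableT_comp (@measurable_ln R)).
exact: measurable_funX.
Qed.

Lemma measurable_det (D : set R) n (A : R -> 'M[R]_n) :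
  (forall i j, measurable_fun D (fun t => A t i j)) ->
  measurable_fun D (fun t => \det (A t)).
Proof.
move=> mA; rewrite /determinant; apply: measurable_sum => s.
apply: measurable_funM => //; apply: measurable_prod => i _; exact: mA.
Qed.

Lemma measurable_adj (D : set R) n (A : R -> 'M[R]_n) i j :
  (forall i j, measurable_fun D (fun t => A t i j)) ->
  measurable_fun D (fun t => \adj (A t) i j).
Proof.
move=> mA; under eq_fun do rewrite mxE /cofactor.
apply: measurable_funM => //; apply: measurable_det => k l.
by under eq_fun do rewrite !mxE; exact: mA.
Qed.

Variables (T0 : R) (E : rel V) (r : V -> V -> R -> R) (w : R -> V -> R).
Hypothesis rA : rates_assumptions T0 E r.
Hypothesis wI : forall t, invariant_distribution r t (w t).
Notation I0 := (@I0 R T0).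

Let r_meas : forall y z, measurable_fun setT (r y z) := rA.1.
Let r_ge0 : forall y z t, 0 <= r y z t := rA.2.1.
Let r_off : forall y z, ~~ E y z -> forall t, r y z t = 0 := rA.2.2.2.2.2.1.
Let E_connected : forall y z, connect E y z := rA.2.2.2.2.2.2.1.

Lemma rates_bounds : exists2 cC : R * R, 0 < cC.1 &
  forall y z t, E y z -> 0 <= t <= T0 -> cC.1 <= r y z t <= cC.2.
Proof. by have [c [C [c0 H]]] := rA.2.2.2.2.2.2.2.1; exists (c, C). Qed.

Lemma rates_gt0 y z t : E y z -> 0 <= t <= T0 -> 0 < r y z t.
Proof.
move=> Eyz tI; have [[c C] /= c0 /(_ y z t Eyz tI)/andP[h _]] := rates_bounds.
exact: lt_le_trans h.
Qed.

Let wb t : balanced (fun y z => r y z t) (w t).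
Proof. by have [_ _ +] := wI t. Qed.

Lemma invariant_le1 t y : w t y <= 1.
Proof.
have [w0 <- _] := wI t; rewrite (bigD1 y)//= lerDl; exact: sumr_ge0.
Qed.

Lemma measurable_invariant y : measurable_fun I0 (fun t => w t y).
Proof.
have gm i j : measurable_fun I0 (fun t => gen_mx (fun y z => r y z t) i j).
  under eq_fun do rewrite mxE.
  apply: measurable_funD => //; apply: measurable_funB; first exact: measurable_funTS.
  case: (i == j) => //; apply: measurable_sum => z; exact: measurable_funTS.
have wE t : I0 t -> w t y = (\sum_i \adj (gen_mx (fun y z => r y z t)) i (enum_rank y)) *
    (\det (gen_mx (fun y z => r y z t)))^-1.
  move=> /I0P tI; have [w0 w1 _] := wI t.
  by apply: (@balanced_adj _ _ E) => // x z Exz; exact: rates_gt0.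
apply: (eq_measurable_fun (fun t => (\sum_i \adj (gen_mx (fun y z => r y z t)) i (enum_rank y)) *
    (\det (gen_mx (fun y z => r y z t)))^-1)).
  by move=> t /set_mem /wE ->.
apply: measurable_funM.
  by apply: measurable_sum => i; exact: measurable_adj.
apply: measurable_invr; last exact: measurable_det.
move=> t /I0P tI; have [w0 w1 _] := wI t.
by apply: (@det_gen_mx _ _ E _ _ _ _ (w t)) => // x z Exz; exact: rates_gt0.
Qed.

Lemma rout_le : exists2 M : R, 0 < M & forall y t, 0 <= t <= T0 -> rout r y t <= M.
Proof.
have [[c C] /= c0 H] := rates_bounds.
(* The summand 1 makes the bound positive, as it later serves as a divisor. *)
exists (\sum_(z : V) `|C| + 1) => [|y t tI].
  by rewrite ltr_wpDl// sumr_ge0.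
rewrite /rout ler_wpDr// ler_sum// => z _.
have [Eyz|/r_off ->//] := boolP (E y z).
have /andP[_ h] := H y z t Eyz tI; exact: le_trans h (ler_norm _).
Qed.

(** Stationarity at [y] bounds a single inflow term by the outflow, so [c * w t x <= M * w t y]
    along an edge from [x] to [y]. Iterating along paths to [z] gives [k y * w t y <= w t z] for
    every [y], with [k y] independent of time; dividing by [k y] and summing uses that [w t] has
    mass 1. *)
Lemma invariant_lower_bound z : exists2 k : R, 0 < k &
  forall t, 0 <= t <= T0 -> k <= w t z.
Proof.
have [[c C] /= c0 H] := rates_bounds.
have [M M0 HM] := rout_le.
have step x y : E x y -> forall t, 0 <= t <= T0 -> c / M * w t x <= w t y.
  move=> Exy t tI; have [w0 _ wbal] := wI t.
  rewrite mulrAC ler_pdivrMr//.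
  apply: (@le_trans _ _ (w t y * rout r y t)); last by rewrite ler_wpM2l// HM.
  rewrite -wbal (bigD1 x)//= mulrC ler_wpDr//.
    by apply: sumr_ge0 => i _; rewrite mulr_ge0.
  by rewrite ler_wpM2l//; have /andP[] := H x y t Exy tI.
have reach y : exists2 k : R, 0 < k & forall t, 0 <= t <= T0 -> k * w t y <= w t z.
  have /connectP[s] := E_connected y z.
  elim: s y => [y _ /= ->|x s IH y /= /andP[Eyx pxs] zl].
    by exists 1 => // t _; rewrite mul1r.
  have [k k0 Hk] := IH x pxs zl.
  exists (k * (c / M)) => [|t tI]; first by rewrite mulr_gt0// divr_gt0.
  apply: le_trans (Hk t tI); rewrite -mulrA ler_pM2l//; exact: step.
pose k y := s2val (cid2 (reach y)).
have k0 y : 0 < k y by rewrite /k; case: cid2.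
have kP y t : 0 <= t <= T0 -> k y * w t y <= w t z.
  by rewrite /k; case: cid2 => /= ? _; exact.
have S0 : 0 < \sum_y (k y)^-1.
  by rewrite (bigD1 z)//= ltr_pwDl ?invr_gt0// sumr_ge0// => i _; rewrite invr_ge0 ltW.
exists (\sum_y (k y)^-1)^-1 => [|t tI]; first by rewrite invr_gt0.
rewrite -[leLHS]mul1r ler_pdivrMr// mulr_sumr; have [_ <- _] := wI t.
by apply: ler_sum => y _; rewrite ler_pdivlMr// mulrC kP.
Qed.

End MeasurableInvariant.

(** * The rate density Phi *)

Section PhiProperties.
Variable R : realType.
Implicit Types q p : R.

Lemma PhiE q p : 0 < q -> 0 < p -> Phi q p = (q * (ln q - ln p) - (q - p))%:E.
Proof. by move=> q0 p0; rewrite /Phi !gt_eqF// ln_div. Qed.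

Lemma Phi0 p : Phi 0 p = p%:E.
Proof. by rewrite /Phi eqxx. Qed.

Lemma Phi_ge0 q p : 0 <= q -> 0 <= p -> (0 <= Phi q p)%E.
Proof.
move=> q0 p0; have [->|qn0] := eqVneq q 0; first by rewrite Phi0 lee_fin.
have [->|pn0] := eqVneq p 0; first by rewrite /Phi (negbTE qn0) eqxx.
have qp : 0 < q by rewrite lt_neqAle eq_sym qn0.
have pp : 0 < p by rewrite lt_neqAle eq_sym pn0.
rewrite PhiE// lee_fin.
have h : ln p - ln q <= p / q - 1 by rewrite -ln_div//; exact/ln_le_subr1/divr_gt0.
have : q * (ln p - ln q) <= q * (p / q - 1) by rewrite ler_pM2l.
have -> : q * (p / q - 1) = p - q by field; rewrite gt_eqF.
lra.
Qed.

(** This separates [q * ln q], whose integral may be infinite, from everything that depends on [p].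
    The first part is left unchanged when the rates are exchanged. *)
Lemma Phi_split q p : 0 <= q -> 0 < p ->
  Phi q p = (Phi q 1 + (p - 1 - q * ln p)%:E)%E.
Proof.
move=> q0 p0; have [->|qn0] := eqVneq q 0.
  by rewrite !Phi0 -EFinD; congr EFin; ring.
have qp : 0 < q by rewrite lt_neqAle eq_sym qn0.
by rewrite !PhiE// ln1 -EFinD; congr EFin; ring.
Qed.

End PhiProperties.

Section IntegralSums.
Context {dd : measure_display} {T : measurableType dd} {R : realType}.
Variables (mu : {measure set T -> \bar R}) (D : set T).
Hypothesis mD : measurable D.

Lemma ge0_integral_sumP (I : Type) (s : seq I) (P : pred I) (f : I -> T -> \bar R) :
  (forall i, P i -> measurable_fun D (f i)) ->
  (forall i x, P i -> D x -> (0 <= f i x)%E) ->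
  (\int[mu]_(x in D) (\sum_(i <- s | P i) f i x) =
   \sum_(i <- s | P i) \int[mu]_(x in D) f i x)%E.
Proof.
move=> mf f0.
under eq_integral do rewrite big_mkcond/=.
rewrite [RHS]big_mkcond/= ge0_integral_sum//.
- by apply: eq_bigr => i _; case: (P i) => //; rewrite integral0.
- by move=> i; case: (boolP (P i)) => Pi //; exact: mf.
- by move=> i x Dx; case: (boolP (P i)) => Pi //; exact: f0.
Qed.

Lemma emeasurable_sumP (I : Type) (s : seq I) (P : pred I) (f : I -> T -> \bar R) :
  (forall i, P i -> measurable_fun D (f i)) ->
  measurable_fun D (fun x => \sum_(i <- s | P i) f i x)%E.
Proof.
move=> mf; under eq_fun do rewrite big_mkcond/=.
by apply: emeasurable_sum => i; case: (boolP (P i)) => Pi //; exact: mf.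
Qed.

Lemma measurable_sumP (I : Type) (s : seq I) (P : pred I) (f : I -> T -> R) :
  (forall i, P i -> measurable_fun D (f i)) ->
  measurable_fun D (fun x => \sum_(i <- s | P i) f i x).
Proof.
move=> mf; under eq_fun do rewrite big_mkcond/=.
by apply: measurable_sum => i; case: (boolP (P i)) => Pi //; exact: mf.
Qed.

Lemma integrable_sumP (I : Type) (s : seq I) (P : pred I) (f : I -> T -> R) :
  (forall i, P i -> mu.-integrable D (EFin \o f i)) ->
  mu.-integrable D (EFin \o (fun x => \sum_(i <- s | P i) f i x)).
Proof.
move=> fi; have := integrable_sum mD s fi.
by apply: eq_integrable => // x _; rewrite /= sumEFin.
Qed.

Lemma Rintegral_sumP (I : Type) (s : seq I) (P : pred I) (f : I -> T -> R) :
  (forall i, P i -> mu.-integrable D (EFin \o f i)) ->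
  Rintegral mu D (fun x => \sum_(i <- s | P i) f i x) =
  \sum_(i <- s | P i) Rintegral mu D (f i).
Proof.
move=> fi; elim: s => [|i s IH].
  rewrite big_nil -[RHS](mul0r (fine (mu D))) -Rintegral_cst//.
  by apply: eq_Rintegral => x _; rewrite big_nil.
rewrite big_cons; case: ifPn => Pi; last first.
  by rewrite -IH; apply: eq_Rintegral => x _; rewrite big_cons (negbTE Pi).
rewrite -IH -RintegralD//; [|exact: fi|exact: integrable_sumP].
by apply: eq_Rintegral => x _; rewrite big_cons Pi.
Qed.

(** The integral of [f] may be infinite and [g] has no sign. The negative part of [g] is moved to
    the other side, so that only nonnegative functions are added, and its finite integral is
    cancelled at the end. *)
Lemma ge0_integralD_integrable (f : T -> \bar R) (g : T -> R) :
  measurable_fun D f -> (forall x, D x -> (0 <= f x)%E) ->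
  (forall x, D x -> (0 <= f x + (g x)%:E)%E) ->
  mu.-integrable D (EFin \o g) ->
  (\int[mu]_(x in D) (f x + (g x)%:E) =
   \int[mu]_(x in D) f x + (Rintegral mu D g)%:E)%E.
Proof.
move=> mf f0 fg0 gi.
have mg := integrable_measurable_fun gi.
pose gp x := Num.max (g x) 0; pose gn x := Num.max (- g x) 0.
have gpn x : g x = gp x - gn x.
  by rewrite /gp /gn; case: (ltP (g x) 0); case: (ltP (- g x) 0); lra.
have gp0 x : 0 <= gp x by rewrite /gp le_max lexx orbT.
have gn0 x : 0 <= gn x by rewrite /gn le_max lexx orbT.
have mgp : measurable_fun D gp by exact: measurable_maxr.
have mgn : measurable_fun D gn by apply: measurable_maxr => //; exact: measurable_funN.
have igp : mu.-integrable D (EFin \o gp).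
  apply: le_integrable gi => //; first exact/measurable_EFinP.
  move=> x Dx /=; rewrite lee_fin ger0_norm// /gp.
  by case: (ltP (g x) 0) => // _; exact: ler_norm.
have ign : mu.-integrable D (EFin \o gn).
  apply: le_integrable gi => //; first exact/measurable_EFinP.
  move=> x Dx /=; rewrite lee_fin ger0_norm// /gn -normrN.
  by case: (ltP (- g x) 0) => // _; exact: ler_norm.
have key : (\int[mu]_(x in D) (f x + (g x)%:E) + \int[mu]_(x in D) (gn x)%:E =
   \int[mu]_(x in D) f x + \int[mu]_(x in D) (gp x)%:E)%E.
  have mfg : measurable_fun D (fun x => f x + (g x)%:E)%E.
    by apply: emeasurable_funD => //; exact/measurable_EFinP.
  have mgnE : measurable_fun D (fun x => (gn x)%:E) by exact/measurable_EFinP.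
  have mgpE : measurable_fun D (fun x => (gp x)%:E) by exact/measurable_EFinP.
  have gn0E x : D x -> (0 <= (gn x)%:E)%E by rewrite lee_fin.
  have gp0E x : D x -> (0 <= (gp x)%:E)%E by rewrite lee_fin.
  rewrite -(ge0_integralD mu mD fg0 mfg gn0E mgnE) -(ge0_integralD mu mD f0 mf gp0E mgpE).
  apply: eq_integral => x _; rewrite -addeA -EFinD; congr (_ + _%:E)%E.
  by rewrite gpn subrK.
have -> : Rintegral mu D g = Rintegral mu D gp - Rintegral mu D gn.
  by rewrite -RintegralB//; apply: eq_Rintegral => x _; exact: gpn.
rewrite EFinB /Rintegral !fineK ?integrable_fin_num//.
by rewrite addeA -key addeK// integrable_fin_num.
Qed.

Lemma measurable_Phi (f p : T -> R) : measurable_fun D f -> measurable_fun D p ->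
  (forall x, D x -> 0 <= f x) -> (forall x, D x -> 0 <= p x) ->
  measurable_fun D (fun x => Phi (f x) (p x)).
Proof.
move=> mf mp f0 p0.
apply: (eq_measurable_fun (fun x => if f x == 0 then (p x)%:E else
  if p x == 0 then +oo%E else (f x * (ln (f x) - ln (p x)) - (f x - p x))%:E)).
  move=> x /set_mem Dx; rewrite /Phi; case: ifPn => // fx; case: ifPn => // px.
  by rewrite ln_div ?posrE// lt_neqAle eq_sym ?fx ?px/= ?f0 ?p0.
apply: measurable_fun_if => //; first exact: measurable_fun_eqr.
  by apply: (@measurable_funS _ _ _ _ D) => //; exact/measurable_EFinP.
apply: (@measurable_funS _ _ _ _ D) => //.
apply: measurable_fun_if => //; first exact: measurable_fun_eqr.
apply: (@measurable_funS _ _ _ _ D) => //.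
apply/measurable_EFinP; apply: measurable_funB; last exact: measurable_funB.
apply: measurable_funM => //; apply: measurable_funB;
  exact: (measurableT_comp (@measurable_ln R)).
Qed.

Hypothesis Dfin : (mu D < +oo)%E.

Lemma ln_bounded_between (lo hi x : R) : 0 < lo -> lo <= x -> x <= hi ->
  `|ln x| <= `|ln lo| + `|ln hi|.
Proof.
move=> lo0 lx xh; have x0 := lt_le_trans lo0 lx.
have l1 : ln lo <= ln x by rewrite ler_ln.
have l2 : ln x <= ln hi by rewrite ler_ln// posrE (lt_le_trans x0 xh).
rewrite ler_norml; have := ler_norm (- ln lo); have := ler_norm (ln hi).
by rewrite normrN => h1 h2; apply/andP; split; have := normr_ge0 (ln lo);
  have := normr_ge0 (ln hi); lra.
Qed.

Lemma integrable_Mln (f p : T -> R) (lo hi : R) : mu.-integrable D (EFin \o f) ->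
  measurable_fun D p -> 0 < lo -> (forall x, D x -> lo <= p x <= hi) ->
  mu.-integrable D (EFin \o (fun x => f x * ln (p x))).
Proof.
move=> fi mp lo0 ph.
apply: (integrableM_bounded (C := `|ln lo| + `|ln hi|)) => //.
  exact: (measurableT_comp (@measurable_ln R)).
by move=> x /ph/andP[h1 h2]; exact: ln_bounded_between.
Qed.

Lemma integral_Phi_split (f p : T -> R) (lo hi : R) : 0 < lo ->
  mu.-integrable D (EFin \o f) -> (forall x, D x -> 0 <= f x) ->
  measurable_fun D p -> (forall x, D x -> lo <= p x <= hi) ->
  (\int[mu]_(x in D) Phi (f x) (p x) = \int[mu]_(x in D) Phi (f x) 1 +
   (Rintegral mu D p - Rintegral mu D (fun=> 1) - Rintegral mu D (fun x => f x * ln (p x)))%:E)%E.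
Proof.
move=> lo0 fi f0 mp ph.
have p0 x : D x -> 0 < p x by move=> /ph/andP[h _]; exact: lt_le_trans h.
have mf := integrable_measurable_fun fi.
have pi : mu.-integrable D (EFin \o p).
  apply: (bounded_integrable (C := hi)) => // x Dx.
  by rewrite gtr0_norm ?p0//; have /andP[] := ph x Dx.
have ci : mu.-integrable D (EFin \o (fun=> 1)).
  by apply: (bounded_integrable (C := 1)) => // x _; rewrite normr1.
have li := integrable_Mln fi mp lo0 ph.
have pci : mu.-integrable D (EFin \o (fun x => p x - 1)) by exact: integrableB_real.
rewrite -RintegralB// -RintegralB//.
rewrite -ge0_integralD_integrable.
- by apply: eq_integral => x /set_mem Dx; rewrite -Phi_split ?f0 ?p0.
- by apply: measurable_Phi => //; exact: measurable_cst.
- by move=> x Dx; apply: Phi_ge0 => //; exact: f0.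
- by move=> x Dx; rewrite -Phi_split ?f0 ?p0//; apply: Phi_ge0; [exact: f0|exact/ltW/p0].
- exact: integrableB_real.
Qed.

End IntegralSums.

(** * Removing the regularisation *)

Section PhiShift.
Context {dd : measure_display} {T : measurableType dd} {R : realType}.
Variables (mu : {measure set T -> \bar R}) (D : set T).
Hypothesis mD : measurable D.
Hypothesis Dfin : (mu D < +oo)%E.

(** [Phi (f x) p] is not monotone in [p], but [Phi (f x) p - p] is: it increases as [p] decreases.
    The bound [p <= 2 * Ca], from [m <= 1] and [harmonic n <= 1], restores nonnegativity, and the
    finite integrals of [2 * Ca - p] converge by themselves. The bounds on [m] hold only off [N], so
    all integrals are first restricted to [D']. *)
Lemma Phi_shift_cvg (f m a : T -> R) (Ca : R) (N : set T) :
  measurable N -> mu N = 0 -> mu.-integrable D (EFin \o f) ->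
  measurable_fun D m -> measurable_fun D a ->
  (forall x, D x -> 0 <= f x) -> (forall x, D x -> 0 <= m x) ->
  (forall x, D x -> 0 < a x <= Ca) ->
  (forall x, D x -> ~ N x -> m x <= 1 /\ (m x = 0 -> f x = 0)) ->
  (\int[mu]_(x in D) Phi (f x) ((m x + harmonic n) * a x))%E @[n --> \oo] -->
  (\int[mu]_(x in D) Phi (f x) (m x * a x))%E.
Proof.
move=> mN N0 fi mm ma f0 m0 a0 DN.
have mf := integrable_measurable_fun fi.
pose D' := D `\` N.
have mD' : measurable D' by exact: measurableD.
have D'D x : D' x -> D x by case.
have h_gt0 n : 0 < harmonic n :> R by rewrite /harmonic/= invr_gt0.
have h_le1 n : harmonic n <= 1 :> R by rewrite /harmonic/= invf_le1// ler1n.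
have a_gt0 x : D x -> 0 < a x by move=> /a0/andP[].
have a_le x : D x -> a x <= Ca by move=> /a0/andP[].
pose p n x := (m x + harmonic n) * a x.
have p_gt0 n x : D x -> 0 < p n x.
  by move=> Dx; rewrite /p mulr_gt0 ?a_gt0// ltr_wpDl// m0.
have mp n : measurable_fun D (p n).
  by apply: measurable_funM => //; exact: measurable_funD.
have m_le1 x : D' x -> m x <= 1 by move=> [Dx Nx]; exact: (DN x Dx Nx).1.
have p_le n x : D' x -> p n x <= 2 * Ca.
  move=> D'x; have Dx := D'D _ D'x; rewrite /p ler_pM ?a_le ?(ltW (a_gt0 _ Dx))//.
    by rewrite addr_ge0 ?m0// ltW.
  by have := m_le1 x D'x; have := h_le1 n; lra.
have p0_le x : D' x -> m x * a x <= 2 * Ca.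
  move=> D'x; have Dx := D'D _ D'x.
  rewrite ler_pM ?a_le ?m0 ?(ltW (a_gt0 _ Dx))//.
  by have := m_le1 x D'x; lra.
have negl g : measurable_fun D g -> (forall x, D x -> 0 <= g x)%E ->
    (\int[mu]_(x in D) g x = \int[mu]_(x in D') g x)%E.
  by move=> mg g0; exact: ge0_negligible_integral.
have mPhi n : measurable_fun D (fun x => Phi (f x) (p n x)).
  by apply: measurable_Phi => // x Dx; exact/ltW/p_gt0.
have mPhi0 : measurable_fun D (fun x => Phi (f x) (m x * a x)).
  apply: measurable_Phi => //; first exact: measurable_funM.
  by move=> x Dx; rewrite mulr_ge0 ?m0// ltW// a_gt0.
rewrite negl//; last first.
  by move=> x Dx; apply: Phi_ge0; [exact: f0|rewrite mulr_ge0 ?m0// ltW// a_gt0].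
have -> : (fun n => \int[mu]_(x in D) Phi (f x) ((m x + harmonic n) * a x))%E =
   (fun n => \int[mu]_(x in D') Phi (f x) (p n x))%E.
  apply/funext => n; rewrite negl//; first exact: mPhi.
  by move=> x Dx; apply: Phi_ge0; [exact: f0|exact/ltW/p_gt0].
(* Phi (f x) (p n x) + (2 Ca - p n x): nonnegative and nondecreasing in n. *)
pose psi n x : R := if f x == 0 then 2 * Ca else
  f x * (ln (f x) - ln (p n x)) - f x + 2 * Ca.
have D'S (f1 : T -> R) : measurable_fun D f1 -> measurable_fun D' f1.
  by apply: measurable_funS => //; exact: subDsetl.
have D'fin : (mu D' < +oo)%E.
  by apply: le_lt_trans Dfin; apply: le_measure; rewrite ?inE//; exact: subDsetl.
have psiE n x : D' x -> (psi n x)%:E = (Phi (f x) (p n x) + (2 * Ca - p n x)%:E)%E.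
  move=> D'x; have Dx := D'D _ D'x; rewrite /psi; have [->|fn0] := eqVneq (f x) 0.
    by rewrite Phi0 -EFinD; congr EFin; ring.
  rewrite PhiE ?p_gt0//; last by rewrite lt_neqAle eq_sym fn0 f0.
  by rewrite -EFinD; congr EFin; ring.
have psi_ge0 n x : D' x -> (0 <= (psi n x)%:E)%E.
  move=> D'x; rewrite psiE// adde_ge0//; last by rewrite lee_fin subr_ge0 p_le.
  by apply: Phi_ge0; [exact/f0/D'D|exact/ltW/p_gt0/D'D].
have cn_int n : mu.-integrable D' (EFin \o (fun x => 2 * Ca - p n x)).
  apply: (bounded_integrable (C := 2 * Ca)) => //.
    by apply: measurable_funB => //; exact: D'S.
  move=> x D'x; have := p_le n x D'x; have := p_gt0 n x (D'D _ D'x) => h1 h2.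
  by rewrite ger0_norm ?subr_ge0//; lra.
have c0_int : mu.-integrable D' (EFin \o (fun x => 2 * Ca - m x * a x)).
  apply: (bounded_integrable (C := 2 * Ca)) => //.
    by apply: measurable_funB => //; apply: D'S; exact: measurable_funM.
  move=> x D'x; have := p0_le x D'x; have h : 0 <= m x * a x.
    by rewrite mulr_ge0 ?m0 ?(ltW (a_gt0 _ _))//; exact: D'D.
  by move=> h2; rewrite ger0_norm ?subr_ge0//; lra.
have psi_int n : (\int[mu]_(x in D') Phi (f x) (p n x) =
    \int[mu]_(x in D') (psi n x)%:E - (Rintegral mu D' (fun x => (2 * Ca - p n x)%R))%:E)%E.
  rewrite (_ : \int[mu]_(x in D') (psi n x)%:E = \int[mu]_(x in D') Phi (f x) (p n x) +
    (Rintegral mu D' (fun x => (2 * Ca - p n x)%R))%:E)%E; first by rewrite addeK.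
  rewrite -(ge0_integralD_integrable mD')//.
  - by apply: eq_integral => x /set_mem D'x; rewrite psiE.
  - by apply: measurable_funS (mPhi n) => //; exact: subDsetl.
  - by move=> x D'x; apply: Phi_ge0; [exact/f0/D'D|exact/ltW/p_gt0/D'D].
  - by move=> x D'x; rewrite -psiE// psi_ge0.
have Phi0_ge0 x : D' x -> (0 <= Phi (f x) (m x * a x))%E.
  move=> D'x; apply: Phi_ge0; first exact/f0/D'D.
  by rewrite mulr_ge0 ?m0 ?(ltW (a_gt0 _ _))//; exact: D'D.
have psi0_int : (\int[mu]_(x in D') Phi (f x) (m x * a x) =
    \int[mu]_(x in D') (Phi (f x) (m x * a x) + (2 * Ca - m x * a x)%:E) -
    (Rintegral mu D' (fun x => (2 * Ca - m x * a x)%R))%:E)%E.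
  rewrite (ge0_integralD_integrable mD')//; first by rewrite addeK.
  - by apply: measurable_funS mPhi0 => //; exact: subDsetl.
  - by move=> x D'x; rewrite adde_ge0 ?Phi0_ge0// lee_fin subr_ge0 p0_le.
have a_int : mu.-integrable D' (EFin \o a).
  apply: (bounded_integrable (C := Ca)) => //; first exact: D'S.
  by move=> x D'x; rewrite gtr0_norm ?a_le ?a_gt0//; exact: D'D.
have cn_cvg : Rintegral mu D' (fun x => 2 * Ca - p n x) @[n --> \oo] -->
    Rintegral mu D' (fun x => 2 * Ca - m x * a x).
  have -> : (fun n => Rintegral mu D' (fun x => 2 * Ca - p n x)) =
      (fun n => Rintegral mu D' (fun x => 2 * Ca - m x * a x) - harmonic n * Rintegral mu D' a).
    apply/funext => n; rewrite -RintegralZl// -RintegralB//; last exact: integrable_cstM.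
    by apply: eq_Rintegral => x _; rewrite /p; ring.
  rewrite -[X in _ --> X]subr0; apply: cvgB; first exact: cvg_cst.
  rewrite -(mul0r (Rintegral mu D' a)); apply: cvgM; last exact: cvg_cst.
  exact: cvg_harmonic.
have mpsi n : measurable_fun D' (EFin \o psi n).
  apply: (eq_measurable_fun (fun x => Phi (f x) (p n x) + (2 * Ca - p n x)%:E)%E).
    by move=> x /set_mem D'x; rewrite /= psiE.
  apply: emeasurable_funD; first by apply: measurable_funS (mPhi n) => //; exact: subDsetl.
  by apply/measurable_EFinP; apply: measurable_funB => //; exact: D'S.
have psi_nd x : D' x -> {homo (fun n => (EFin \o psi n) x) : n k / (n <= k)%N >-> (n <= k)%E}.
  move=> D'x n k nk; have Dx := D'D _ D'x; rewrite lee_fin /psi; case: ifPn => // fn0.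
  rewrite lerD2r lerD2r ler_wpM2l ?f0// lerD2l lerN2 ler_ln ?posrE ?p_gt0//.
  rewrite /p ler_pM2r ?a_gt0// lerD2l /harmonic/= lef_pV2 ?posrE ?ltr0n//.
  by rewrite ler_nat ltnS.
have psi_cvg x : D' x -> (psi n x)%:E @[n --> \oo] -->
    (Phi (f x) (m x * a x) + (2 * Ca - m x * a x)%:E)%E.
  move=> D'x; have Dx := D'D _ D'x; rewrite /psi; have [fx|fn0] := eqVneq (f x) 0.
    rewrite fx Phi0 -EFinD (_ : m x * a x + _ = 2 * Ca); last by ring.
    exact: cvg_cst.
  (* Off [N], flow without mass is excluded, so the limit stays inside the domain where [ln] is
     continuous. *)
  have mx0 : 0 < m x.
    rewrite lt_neqAle m0// andbT eq_sym; apply/eqP => mx; case: D'x => _ Nx.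
    by move/eqP: fn0; apply; exact: (DN x Dx Nx).2.
  have ma0 : 0 < m x * a x by rewrite mulr_gt0 ?a_gt0.
  rewrite PhiE//; last by rewrite lt_neqAle eq_sym fn0 f0.
  rewrite -EFinD (_ : f x * (ln (f x) - ln (m x * a x)) - (f x - m x * a x) +
    (2 * Ca - m x * a x) = f x * (ln (f x) - ln (m x * a x)) - f x + 2 * Ca); last by ring.
  apply: cvg_EFin; first by near=> n.
  apply: cvgD; last exact: cvg_cst.
  apply: cvgB; last exact: cvg_cst.
  apply: cvgM; first exact: cvg_cst.
  apply: cvgB; first exact: cvg_cst.
  apply: (@cvg_comp _ _ _ _ _ _ (nbhs (m x * a x))); last exact: continuous_ln.
  rewrite /p; apply: cvgM; last exact: cvg_cst.
  rewrite -[X in _ --> X]addr0; apply: cvgD; first exact: cvg_cst.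
  exact: cvg_harmonic.
have psi_lim : (\int[mu]_(x in D') (psi n x)%:E)%E @[n --> \oo] -->
    (\int[mu]_(x in D') (Phi (f x) (m x * a x) + (2 * Ca - m x * a x)%:E))%E.
  rewrite (_ : (\int[mu]_(x in D') (Phi (f x) (m x * a x) + (2 * Ca - m x * a x)%:E))%E =
    (\int[mu]_(x in D') limn (fun n => (EFin \o psi n) x))%E).
    exact: (cvg_monotone_convergence mD' mpsi psi_ge0 psi_nd).
  apply: eq_integral => x /set_mem D'x; apply/esym/cvg_lim => //.
  exact: psi_cvg.
rewrite psi0_int; under eq_fun do rewrite psi_int.
apply: cvgeB => //; first exact: fin_num_adde_defl.
by apply: cvg_EFin => //; near=> n.
Unshelve. all: by end_near. Qed.

End PhiShift.

(** * Exchanging the endpoints of the edges *)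

Section EdgeSums.
Variables (V : finType) (E : rel V).
Hypothesis E_sym : symmetric_E E.

Lemma edge_sum_swap (T : Type) (idx : T) (op : Monoid.com_law idx) (F : V -> V -> T) :
  \big[op/idx]_(y : V) \big[op/idx]_(z : V | E y z) F y z =
  \big[op/idx]_(y : V) \big[op/idx]_(z : V | E y z) F z y.
Proof.
rewrite (exchange_big_dep xpredT)//=; apply: eq_bigr => z _.
by apply: eq_bigl => y; rewrite E_sym.
Qed.

End EdgeSums.

Section PhiIdentity.
Context {dd : measure_display} {T : measurableType dd} {R : realType}.
Variables (mu : {measure set T -> \bar R}) (D : set T).
Hypothesis mD : measurable D.
Hypothesis Dfin : (mu D < +oo)%E.
Variables (V : finType) (E : rel V).
Hypothesis E_sym : symmetric_E E.
Variables (Q : V -> V -> T -> R) (m : V -> T -> R).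
Hypothesis Q_int : forall y z, E y z -> mu.-integrable D (EFin \o Q y z).
Hypothesis Q_ge0 : forall y z x, E y z -> D x -> 0 <= Q y z x.
Hypothesis m_meas : forall y, measurable_fun D (m y).
Hypothesis m01 : forall y x, D x -> 0 <= m y x <= 1.

(** The expression [divQ] over an arbitrary measure space. *)
Definition divergence (y : V) (x : T) : R :=
  \sum_(z : V | E y z) Q y z x - \sum_(z : V | E z y) Q z y x.

(** Discrete integration by parts: exchanging endpoints in the inflow sum turns the divergence into
    differences of [ln h] along edges. It serves both the regularised mass and the accompanying
    distribution. *)
Lemma divergence_pairing (h : V -> T -> R) (lo hi : R) : 0 < lo ->
  (forall y, measurable_fun D (h y)) ->
  (forall y x, D x -> lo <= h y x <= hi) ->
  \sum_(y : V) Rintegral mu D (fun x => divergence y x * ln (h y x)) =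
  \sum_(y : V) \sum_(z : V | E y z)
    (Rintegral mu D (fun x => Q y z x * ln (h y x)) -
     Rintegral mu D (fun x => Q y z x * ln (h z x))).
Proof.
move=> lo0 mh hb.
have I y z x : E y z -> mu.-integrable D (EFin \o (fun t => Q y z t * ln (h x t))).
  by move=> Eyz; apply: (integrable_Mln mD _ _ lo0 (hb x)) => //; exact: Q_int.
under [RHS]eq_bigr do rewrite sumrB.
rewrite [RHS]sumrB [X in _ = _ - X](edge_sum_swap E_sym) -sumrB.
apply: eq_bigr => y _.
have E' z : E y z -> E z y by rewrite E_sym.
rewrite -(Rintegral_sumP mD); last by move=> z; exact: I.
rewrite -(Rintegral_sumP mD); last by move=> z /E'; exact: I.
rewrite -RintegralB//; last 2 first.
- by apply: integrable_sumP => // z; exact: I.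
- by apply: integrable_sumP => // z /E'; exact: I.
apply: eq_Rintegral => x _; rewrite /divergence mulrBl !mulr_suml; congr (_ - _).
by apply: eq_bigl => z; rewrite E_sym.
Qed.

Hypothesis log_div0 : forall del y, 0 < del ->
  Rintegral mu D (fun x => divergence y x * ln (m y x + del)) = 0.
Variable N : set T.
Hypotheses (mN : measurable N) (N0 : mu N = 0).
Hypothesis m_eq0 : forall x, D x -> ~ N x -> forall y z, E y z ->
  (m y x = 0 -> Q y z x = 0) /\ (m z x = 0 -> Q y z x = 0).
Variables (a b : V -> V -> T -> R) (c C : R).
Hypothesis c_gt0 : 0 < c.
Hypothesis a_meas : forall y z, E y z -> measurable_fun D (a y z).
Hypothesis b_meas : forall y z, E y z -> measurable_fun D (b y z).
Hypothesis a_bnd : forall y z x, E y z -> D x -> c <= a y z x <= C.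
Hypothesis b_bnd : forall y z x, E y z -> D x -> c <= b y z x <= C.

Let h (n : nat) : R := harmonic n.
Let h_gt0 n : 0 < h n. Proof. by rewrite /h /harmonic/= invr_gt0. Qed.
Let h_le1 n : h n <= 1. Proof. by rewrite /h /harmonic/= invf_le1// ler1n. Qed.

Let mh_bnd n y x : D x -> h n <= m y x + h n <= 2.
Proof. by move=> Dx; have := m01 y Dx; have := h_le1 n; lra. Qed.

Let mh_meas n y : measurable_fun D (fun x => m y x + h n).
Proof. exact: measurable_funD. Qed.

Let shifted_bnd n y (k : T -> R) x : D x -> c <= k x <= C ->
  h n * c <= (m y x + h n) * k x <= 2 * C.
Proof.
move=> Dx /andP[k1 k2]; have /andP[h1 h2] := mh_bnd n y Dx; have h0 := h_gt0 n.
have k0 : 0 < k x by exact: lt_le_trans k1.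
by apply/andP; split; apply: ler_pM => //; rewrite ltW// (lt_le_trans h0).
Qed.

(** The vertex [x] stands for either endpoint, so one computation covers the tail with rate [a] and
    the head with rate [b]. *)
Let split_term n y z x (k : T -> R) : E y z -> measurable_fun D k ->
  (forall t, D t -> c <= k t <= C) ->
  (\int[mu]_(t in D) Phi (Q y z t) ((m x t + h n) * k t) =
  \int[mu]_(t in D) Phi (Q y z t) 1 +
  (Rintegral mu D (fun t => m x t * k t) + h n * Rintegral mu D k - Rintegral mu D (fun=> 1)
    - (Rintegral mu D (fun t => Q y z t * ln (m x t + h n)) +
       Rintegral mu D (fun t => Q y z t * ln (k t))))%:E)%E.
Proof.
move=> Eyz mk kb.
have k_gt0 t : D t -> 0 < k t by move=> /kb/andP[h1 _]; exact: lt_le_trans h1.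
have ki : mu.-integrable D (EFin \o k).
  apply: (bounded_integrable (C := C)) => // t Dt.
  by rewrite gtr0_norm ?k_gt0//; have /andP[] := kb t Dt.
have mki : mu.-integrable D (EFin \o (fun t => m x t * k t)).
  apply: (bounded_integrable (C := C)) => //; first exact: measurable_funM.
  move=> t Dt; have /andP[m0 m1] := m01 x Dt; have /andP[k1 k2] := kb t Dt.
  rewrite ger0_norm ?mulr_ge0 ?(ltW (k_gt0 _ Dt))//.
  by apply: le_trans k2; rewrite ger_pMl// k_gt0.
rewrite (integral_Phi_split mD Dfin (lo := h n * c) (hi := 2 * C))//.
- congr (_ + _%:E)%E; congr (_ - _ - _).
    rewrite -RintegralZl// -RintegralD//; last exact: integrable_cstM.
    by apply: eq_Rintegral => t _; rewrite mulrDl.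
  rewrite -RintegralD//.
  + apply: eq_Rintegral => t /set_mem Dt; rewrite lnM ?posrE ?k_gt0 ?mulrDr//.
    by have /andP[h1 _] := mh_bnd n x Dt; exact: lt_le_trans h1.
  + by apply: (integrable_Mln mD _ _ (h_gt0 n) (mh_bnd n x)) => //; exact: Q_int.
  + by apply: (integrable_Mln mD _ _ c_gt0 kb) => //; exact: Q_int.
- exact: mulr_gt0.
- exact: Q_int.
- by move=> t Dt; exact: Q_ge0.
- exact: measurable_funM.
- by move=> t Dt; apply: shifted_bnd => //; exact: kb.
Qed.

Let A n := (\sum_(y : V) \sum_(z : V | E y z)
  \int[mu]_(t in D) Phi (Q y z t) ((m y t + h n) * a y z t))%E.
Let B n := (\sum_(y : V) \sum_(z : V | E y z)
  \int[mu]_(t in D) Phi (Q y z t) ((m z t + h n) * b y z t))%E.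

(** The entropy term of the limit; [s1] below is the coefficient of the shift [h n] and disappears
    with it. *)
Let s0 : R := \sum_(y : V) \sum_(z : V | E y z)
  (Rintegral mu D (fun t => Q y z t * ln (a y z t)) -
   Rintegral mu D (fun t => Q y z t * ln (b y z t)))
  + \sum_(y : V) \sum_(z : V | E y z)
  (Rintegral mu D (fun t => m z t * b y z t) - Rintegral mu D (fun t => m y t * a y z t)).
Let s1 : R := \sum_(y : V) \sum_(z : V | E y z)
  (Rintegral mu D (b y z) - Rintegral mu D (a y z)).

(** The integrals of [Phi (Q y z) 1] are common to both sides and stay untouched even when infinite,
    so only an identity between real numbers remains. *)
Let BA n : B n = (A n + (s0 + h n * s1)%:E)%E.
Proof.
pose K y z := (\int[mu]_(t in D) Phi (Q y z t) 1)%E.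
pose al y z := Rintegral mu D (fun t => m y t * a y z t) + h n * Rintegral mu D (a y z) -
   Rintegral mu D (fun=> 1) - (Rintegral mu D (fun t => Q y z t * ln (m y t + h n)) +
       Rintegral mu D (fun t => Q y z t * ln (a y z t))).
pose be y z := Rintegral mu D (fun t => m z t * b y z t) + h n * Rintegral mu D (b y z) -
   Rintegral mu D (fun=> 1) - (Rintegral mu D (fun t => Q y z t * ln (m z t + h n)) +
       Rintegral mu D (fun t => Q y z t * ln (b y z t))).
have -> : A n = (\sum_(y : V) \sum_(z : V | E y z) K y z +
    (\sum_(y : V) \sum_(z : V | E y z) al y z)%:E)%E.
  rewrite -sumEFin -big_split/=; apply: eq_bigr => y _.
  rewrite -sumEFin -big_split/=; apply: eq_bigr => z Eyz.
  by apply: split_term => //; [exact: a_meas|move=> t Dt; exact: a_bnd].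
have -> : B n = (\sum_(y : V) \sum_(z : V | E y z) K y z +
    (\sum_(y : V) \sum_(z : V | E y z) be y z)%:E)%E.
  rewrite -sumEFin -big_split/=; apply: eq_bigr => y _.
  rewrite -sumEFin -big_split/=; apply: eq_bigr => z Eyz.
  by apply: split_term => //; [exact: b_meas|move=> t Dt; exact: b_bnd].
rewrite -addeA; congr (_ + _)%E; rewrite -EFinD; congr EFin.
have L0 := divergence_pairing (h_gt0 n) (mh_meas n) (mh_bnd n).
rewrite big1 in L0; last by move=> y _; exact: log_div0.
(* With the vanishing logarithmic pairing added, the identity holds edge by edge. *)
rewrite -[RHS]addr0 [X in _ = _ + X]L0 /s0 /s1 mulr_sumr.
rewrite -!big_split/=; apply: eq_bigr => y _.
rewrite mulr_sumr -!big_split/=; apply: eq_bigr => z _.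
by rewrite /al /be; ring.
Qed.

Let edge_cvg (F : nat -> V -> V -> \bar R) (G : V -> V -> \bar R) :
  (forall n y z, E y z -> (0 <= F n y z)%E) ->
  (forall y z, E y z -> F n y z @[n --> \oo] --> G y z) ->
  (\sum_(y : V) \sum_(z : V | E y z) F n y z)%E @[n --> \oo] -->
  (\sum_(y : V) \sum_(z : V | E y z) G y z)%E.
Proof.
move=> F0 FG; apply: cvg_nnesum => [y _|y _].
  by near=> n; apply: sume_ge0 => z; exact: F0.
apply: cvg_nnesum => [z Eyz|z Eyz]; last exact: FG.
by near=> n; exact: F0.
Unshelve. all: by end_near. Qed.

Let sumint (p : V -> V -> T -> R) : (forall y z, E y z -> measurable_fun D (p y z)) ->
  (forall y z t, E y z -> D t -> 0 <= p y z t) ->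
  (\int[mu]_(t in D) \sum_(y : V) \sum_(z : V | E y z) Phi (Q y z t) (p y z t) =
   \sum_(y : V) \sum_(z : V | E y z) \int[mu]_(t in D) Phi (Q y z t) (p y z t))%E.
Proof.
move=> mp p0.
have mPhi y z : E y z -> measurable_fun D (fun t => Phi (Q y z t) (p y z t)).
  move=> Eyz; apply: measurable_Phi => //.
  - exact: (integrable_measurable_fun (Q_int Eyz)).
  - exact: mp.
  - by move=> t Dt; exact: Q_ge0.
  - by move=> t Dt; exact: p0.
have Phi0 y z t : E y z -> D t -> (0 <= Phi (Q y z t) (p y z t))%E.
  by move=> Eyz Dt; apply: Phi_ge0; [exact: Q_ge0|exact: p0].
rewrite ge0_integral_sumP//.
- apply: eq_bigr => y _; apply: (ge0_integral_sumP mu mD) => [z Eyz|z t Eyz Dt].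
    exact: mPhi.
  exact: Phi0.
- by move=> y _; apply: emeasurable_sumP => // z; exact: mPhi.
- by move=> y t _ Dt; apply: sume_ge0 => z Eyz; exact: Phi0.
Qed.

(** The sequence [B n] has two limits, one computed directly and one through [A n] plus a finite
    term; limits in the extended reals are unique. What remains is to write [s0] with quotients of
    rates and with escape rates. *)
Lemma integral_Phi_swap :
  (\int[mu]_(t in D) \sum_(y : V) \sum_(z : V | E y z) Phi (Q y z t) (m z t * b y z t) =
   \int[mu]_(t in D) \sum_(y : V) \sum_(z : V | E y z) Phi (Q y z t) (m y t * a y z t) +
   (\sum_(y : V) \sum_(z : V | E y z)
      Rintegral mu D (fun t => Q y z t * ln (a y z t / b y z t))
    + \sum_(y : V) Rintegral mu D (fun t => m y t *
       (\sum_(z : V | E z y) b z y t - \sum_(z : V | E y z) a y z t)))%:E)%E.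
Proof.
have a_gt0 y z t : E y z -> D t -> 0 < a y z t.
  by move=> Eyz Dt; have /andP[h1 _] := a_bnd Eyz Dt; exact: lt_le_trans h1.
have b_gt0 y z t : E y z -> D t -> 0 < b y z t.
  by move=> Eyz Dt; have /andP[h1 _] := b_bnd Eyz Dt; exact: lt_le_trans h1.
have m_ge0 y t : D t -> 0 <= m y t by move=> Dt; have /andP[] := m01 y Dt.
rewrite sumint; last 2 first.
- by move=> y z Eyz; apply: measurable_funM => //; exact: b_meas.
- by move=> y z t Eyz Dt; rewrite mulr_ge0 ?m_ge0// ltW// b_gt0.
rewrite sumint; last 2 first.
- by move=> y z Eyz; apply: measurable_funM => //; exact: a_meas.
- by move=> y z t Eyz Dt; rewrite mulr_ge0 ?m_ge0// ltW// a_gt0.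
have Phi_h_ge0 n y z x (k : T -> R) : E y z -> (forall t, D t -> 0 < k t) ->
    (0 <= \int[mu]_(t in D) Phi (Q y z t) ((m x t + h n) * k t))%E.
  move=> Eyz k0; apply: integral_ge0 => t Dt; apply: Phi_ge0; first exact: Q_ge0.
  by rewrite mulr_ge0 ?addr_ge0 ?m_ge0 ?(ltW (h_gt0 n))// ltW// k0.
have Acvg : A n @[n --> \oo] --> (\sum_(y : V) \sum_(z : V | E y z)
    \int[mu]_(t in D) Phi (Q y z t) (m y t * a y z t))%E.
  apply: edge_cvg => [n y z Eyz|y z Eyz].
    by apply: Phi_h_ge0 => // t Dt; exact: a_gt0.
  apply: (Phi_shift_cvg mD Dfin mN N0 (Ca := C)) => //.
  - exact: Q_int.
  - exact: a_meas.
  - by move=> t Dt; exact: Q_ge0.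
  - by move=> t Dt; exact: m_ge0.
  - by move=> t Dt; rewrite a_gt0//; have /andP[] := a_bnd Eyz Dt.
  - move=> t Dt Nt; split; first by have /andP[] := m01 y Dt.
    exact: (m_eq0 Dt Nt Eyz).1.
have Bcvg : B n @[n --> \oo] --> (\sum_(y : V) \sum_(z : V | E y z)
    \int[mu]_(t in D) Phi (Q y z t) (m z t * b y z t))%E.
  apply: edge_cvg => [n y z Eyz|y z Eyz].
    by apply: Phi_h_ge0 => // t Dt; exact: b_gt0.
  apply: (Phi_shift_cvg mD Dfin mN N0 (Ca := C)) => //.
  - exact: Q_int.
  - exact: b_meas.
  - by move=> t Dt; exact: Q_ge0.
  - by move=> t Dt; exact: m_ge0.
  - by move=> t Dt; rewrite b_gt0//; have /andP[] := b_bnd Eyz Dt.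
  - move=> t Dt Nt; split; first by have /andP[] := m01 z Dt.
    exact: (m_eq0 Dt Nt Eyz).2.
have Bcvg' : B n @[n --> \oo] --> (\sum_(y : V) \sum_(z : V | E y z)
    \int[mu]_(t in D) Phi (Q y z t) (m y t * a y z t) + s0%:E)%E.
  under eq_fun do rewrite BA.
  apply: cvgeD => //; first exact: fin_num_adde_defl.
  apply: cvg_EFin; first by near=> n.
  rewrite -[X in _ --> X]addr0; apply: cvgD; first exact: cvg_cst.
  rewrite -(mul0r s1); apply: cvgM; last exact: cvg_cst.
  exact: cvg_harmonic.
rewrite (@cvg_unique _ (@ereal_hausdorff R) _ _ _ _ Bcvg Bcvg'); congr (_ + _%:E)%E.
have Qln y z (k : T -> R) : E y z -> measurable_fun D k -> (forall t, D t -> c <= k t <= C) ->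
    mu.-integrable D (EFin \o (fun t => Q y z t * ln (k t))).
  by move=> Eyz mk kb; apply: (integrable_Mln mD _ _ c_gt0 kb) => //; exact: Q_int.
have mki x (k : T -> R) : measurable_fun D k -> (forall t, D t -> c <= k t <= C) ->
    mu.-integrable D (EFin \o (fun t => m x t * k t)).
  move=> mk kb; apply: (bounded_integrable (C := C)) => //; first exact: measurable_funM.
  move=> t Dt; have /andP[m0 m1] := m01 x Dt; have /andP[k1 k2] := kb t Dt.
  have k0 : 0 < k t by exact: lt_le_trans k1.
  rewrite ger0_norm ?mulr_ge0 ?(ltW k0)//.
  by apply: le_trans k2; rewrite ger_pMl.
rewrite /s0; congr (_ + _).
  apply: eq_bigr => y _; apply: eq_bigr => z Eyz.
  rewrite -RintegralB//.
  - apply: eq_Rintegral => t /set_mem Dt.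
    by rewrite -mulrBr ln_div ?posrE ?a_gt0 ?b_gt0.
  - by apply: Qln => //; [exact: a_meas|move=> t; exact: a_bnd].
  - by apply: Qln => //; [exact: b_meas|move=> t; exact: b_bnd].
have E' y z : E y z -> E z y by rewrite E_sym.
under eq_bigr do rewrite sumrB.
(* The mass terms with rate [b] sit at heads of edges; the exchange attaches them to the same vertex
   as those with rate [a]. *)
rewrite sumrB [X in X - _](edge_sum_swap E_sym) -sumrB.
apply: eq_bigr => y _.
have ib z : E y z -> mu.-integrable D (EFin \o (fun t => m y t * b z y t)).
  by move=> /E' Ezy; apply: mki; [exact: b_meas|move=> t; exact: b_bnd].
have ia z : E y z -> mu.-integrable D (EFin \o (fun t => m y t * a y z t)).
  by move=> Eyz; apply: mki; [exact: a_meas|move=> t; exact: a_bnd].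
rewrite -(Rintegral_sumP mD _ ib) -(Rintegral_sumP mD _ ia).
rewrite -RintegralB//; [|exact: integrable_sumP..].
apply: eq_Rintegral => t _; rewrite mulrBr !mulr_sumr; congr (_ - _).
by apply: eq_bigl => z; rewrite E_sym.
Unshelve. all: by end_near. Qed.

End PhiIdentity.

(** * Time reversal on Lambda *)

Section LambdaFacts.
Variables (R : realType) (V : finType) (T0 : R) (E : rel V).
Hypothesis T0_gt0 : 0 < T0.
Hypothesis E_sym : symmetric_E E.
Notation leb := (@leb R).
Notation I0 := (@I0 R T0).

Let mI0 := @measurable_I0_leb R T0.
Let I0fin : (leb I0 < +oo)%E := leb_I0_lty T0.

Lemma eq_Rintegral_ae (f g : R -> R) : measurable_fun I0 f -> measurable_fun I0 g ->
  {ae leb, forall t, I0 t -> f t = g t} -> Rintegral leb I0 f = Rintegral leb I0 g.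
Proof.
move=> mf mg fg; rewrite /Rintegral; congr fine.
apply: ae_eq_integral => //; [exact/measurable_EFinP..|].
by apply: ae_weaken fg => t fgt It; rewrite fgt.
Qed.

Lemma RintegralN_int (f : R -> R) : leb.-integrable I0 (EFin \o f) ->
  Rintegral leb I0 (fun t => - f t) = - Rintegral leb I0 f.
Proof.
move=> fi; rewrite -[RHS]mulN1r -RintegralZl//.
by apply: eq_Rintegral => t _; rewrite mulN1r.
Qed.

Section OnePair.
Variables (mu : V -> R -> R) (Q : V -> V -> R -> R).
Hypothesis L : in_Lambda T0 E mu Q.

Lemma Lambda_mu_meas y : measurable_fun I0 (mu y). Proof. exact: L.1. Qed.
Lemma Lambda_mu_ge0 y t : 0 <= t <= T0 -> 0 <= mu y t. Proof. exact: L.2.1. Qed.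
Lemma Lambda_Q_ge0 y z t : E y z -> 0 <= t <= T0 -> 0 <= Q y z t.
Proof. exact: L.2.2.2.1. Qed.
Lemma Lambda_Q_int y z : E y z -> leb.-integrable I0 (EFin \o Q y z).
Proof. exact: L.2.2.2.2.1. Qed.
Lemma Lambda_Q_meas y z : E y z -> measurable_fun I0 (Q y z).
Proof. exact: L.2.2.1. Qed.

Lemma Lambda_mu_le1 : {ae leb, forall t, I0 t -> forall y, mu y t <= 1}.
Proof.
have := L.2.2.2.2.2.1; apply: ae_weaken => t h /I0P It y.
rewrite -(h It) (bigD1 y)//= lerDl; apply: sumr_ge0 => z _; exact: Lambda_mu_ge0.
Qed.

Lemma Lambda_mu_int y : leb.-integrable I0 (EFin \o mu y).
Proof.
have mmu : measurable_fun I0 (EFin \o mu y).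
  by apply/measurable_EFinP; exact: Lambda_mu_meas.
apply/integrableP; split => //.
apply: (@le_lt_trans _ _ (\int[leb]_(t in I0) (cst 1%:E) t)%E); last first.
  by rewrite integral_cst// mul1e.
apply: ae_ge0_le_integral => //.
- exact: measurableT_comp.
- have := Lambda_mu_le1; apply: ae_weaken => t h It.
  by rewrite /= lee_fin ger0_norm ?h//; apply: Lambda_mu_ge0; exact/I0P.
Qed.

Lemma Lambda_divQ_int y : leb.-integrable I0 (EFin \o divQ E Q y).
Proof.
apply: integrableB_real => //; apply: integrable_sumP => // z; exact: Lambda_Q_int.
Qed.

(** A test function that vanishes at all other vertices decouples the continuity equation. *)
Lemma Lambda_weak y (f : R -> R) : (forall t, derivable f t 1) ->
  continuous (derive1 f) -> (forall t, f (t + T0) = f t) ->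
  Rintegral leb I0 (fun t => mu y t * derive1 f t) =
  Rintegral leb I0 (fun t => divQ E Q y t * f t).
Proof.
move=> df cf pf.
pose g (x : V) : R -> R := if x == y then f else cst 0.
have tg : test_fun T0 g.
  move=> x; rewrite /g; case: (x == y); split => //.
  rewrite (_ : derive1 (cst 0 : R -> R) = cst 0); first by move=> t; exact: cvg_cst.
  by apply/funext => t; rewrite derive1_cst.
have := L.2.2.2.2.2.2.1 g tg; rewrite /Rintegral.
rewrite (_ : (\int[leb]_(s in I0) (\sum_x mu x s * derive1 (g x) s)%:E)%E =
  (\int[leb]_(s in I0) (mu y s * derive1 f s)%:E)%E); last first.
  apply: eq_integral => s _; rewrite (bigD1 y)//= {1}/g eqxx big1 ?addr0// => x xy.
  by rewrite /g (negbTE xy) derive1_cst mulr0.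
rewrite (_ : (\int[leb]_(s in I0) (\sum_x divQ E Q x s * g x s)%:E)%E =
  (\int[leb]_(s in I0) (divQ E Q y s * f s)%:E)%E); last first.
  apply: eq_integral => s _; rewrite (bigD1 y)//= {1}/g eqxx big1 ?addr0// => x xy.
  by rewrite /g (negbTE xy) mulr0.
by move=> ->.
Qed.

Lemma Lambda_zero : {ae leb, forall t, I0 t -> forall y z, E y z ->
  (mu y t = 0 -> Q y z t = 0) /\ (mu z t = 0 -> Q y z t = 0)}.
Proof.
have dz : {ae leb, forall t, forall y, I0 t -> mu y t = 0 -> divQ E Q y t = 0}.
  apply: ae_forall => y; apply: (ae_zero_divergence T0_gt0) => //.
  - exact: Lambda_mu_int.
  - exact: Lambda_divQ_int.
  - exact: Lambda_weak.
  - by move=> t; exact: Lambda_mu_ge0.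
have := ae_and dz L.2.2.2.2.2.2.2; apply: ae_weaken => t [dt zt] It y z Eyz.
have It' : 0 <= t <= T0 by exact/I0P.
split; first exact: zt.
(* At [z] both divergence and outflow are zero; the inflow is then a vanishing sum of nonnegative
   terms, so each term is zero. *)
move=> mz; have := dt z It mz; rewrite /divQ [X in X - _]big1; last first.
  by move=> x Ezx; exact: zt.
rewrite sub0r => /eqP; rewrite oppr_eq0 psumr_eq0; last first.
  by move=> x Exz; exact: Lambda_Q_ge0.
by move=> /allP /(_ y (mem_index_enum _)) /implyP /(_ Eyz) /eqP.
Qed.

Lemma theta_Lambda : in_Lambda T0 E (thmu T0 mu) (thQ T0 Q).
Proof.
have rI t : 0 <= t <= T0 -> 0 <= T0 - t <= T0 by move=> /I0P/I0_reflectP/I0P.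
have E' y z : E y z -> E z y by rewrite E_sym.
have divE y t : divQ E (thQ T0 Q) y t = - divQ E Q y (T0 - t).
  rewrite /divQ /thQ opprB; congr (_ - _); apply: eq_bigl => z; exact: E_sym.
split; first by move=> y; apply: measurable_fun_reflect; exact: Lambda_mu_meas.
split; first by move=> y t /rI; exact: Lambda_mu_ge0.
split; first by move=> y z /E' Ezy; exact: (measurable_fun_reflect (Lambda_Q_meas Ezy)).
split; first by move=> y z t /E' Ezy /rI; exact: Lambda_Q_ge0.
split; first by move=> y z /E' Ezy; exact: (integrable_reflect (Lambda_Q_int Ezy)).
split.
  have := ae_reflect T0 L.2.2.2.2.2.1.
  by apply: ae_weaken => t h /rI; exact: h.
split; last first.
  (* Outflow of the reversed pair is inflow of the original one, hence the second half of
     [Lambda_zero]. *)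
  have := ae_reflect T0 Lambda_zero; apply: ae_weaken => t h /I0P/I0_reflectP It y z /E' Ezy.
  exact: (h It z y Ezy).2.
move=> f tf.
(* The minus sign cancels the one from the chain rule, so that [g'] is the reflected [f']; on the
   other side it matches the sign change of the divergence under reversal. *)
pose g y (t : R) : R := - f y (T0 - t).
have dg y (t : R) : is_derive t 1 (g y) (derive1 (f y) (T0 - t)).
  have [df _ _] := tf y.
  have d1 : is_derive (T0 - t) 1 (f y) (derive1 (f y) (T0 - t)).
    by split => //; rewrite derive1E.
  have d2 : is_derive t 1 (fun s : R => T0 - s) (-1).
    apply: (@quadratic_remainder_is_derive _ _ _ _ 0) => k.
    by rewrite mul0r (_ : _ - _ = 0) ?normr0//; ring.
  have := is_deriveN (@is_derive1_comp R (f y) (fun s => T0 - s) t _ _ d1 d2).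
  by rewrite mulrN1 opprK.
have dgE y t : derive1 (g y) t = derive1 (f y) (T0 - t).
  by rewrite derive1E; have [_] := dg y t.
have tg : test_fun T0 g.
  move=> y; have [df cf pf] := tf y; split.
  - by move=> t; have [] := dg y t.
  - rewrite (_ : derive1 (g y) = derive1 (f y) \o (fun t => T0 - t)); last exact/funext.
    move=> t; apply: continuous_comp; last exact: cf.
    by apply: cvgB; [exact: cvg_cst|exact: cvg_id].
  - move=> t; rewrite /g; congr (- _); rewrite -[in RHS](subrK T0 (T0 - t)).
    by rewrite pf; congr (f y _); rewrite opprD addrA.
have mdiv y : measurable_fun I0 (divQ E Q y).
  exact: (integrable_measurable_fun (Lambda_divQ_int y)).
have mf y : measurable_fun I0 (f y).
  apply: measurable_funTS; apply: continuous_measurable_fun => t.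
  by have [/(_ t)/derivable1_diffP/differentiable_continuous] := tf y.
have mdf y : measurable_fun I0 (derive1 (f y)).
  by apply: measurable_funTS; apply: continuous_measurable_fun; have [] := tf y.
transitivity (\int[leb]_(s in I0) (\sum_y mu y s * derive1 (g y) s)%:E)%E.
  rewrite -[RHS](@integral_reflect _ T0 (fun s => (\sum_y mu y s * derive1 (g y) s)%:E)).
    by apply: eq_integral => s _; congr EFin; apply: eq_bigr => y _; rewrite dgE /thmu reflectK.
  apply/measurable_EFinP; apply: measurable_sum => y; apply: measurable_funM.
    exact: Lambda_mu_meas.
  rewrite (_ : derive1 (g y) = fun t => derive1 (f y) (T0 - t)); last exact/funext.
  exact: (measurable_fun_reflect (mdf y)).
rewrite (L.2.2.2.2.2.2.1 g tg).
rewrite -[LHS](@integral_reflect _ T0 (fun s => (\sum_y divQ E Q y s * g y s)%:E)).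
  apply: eq_integral => s _; congr EFin; apply: eq_bigr => y _.
  by rewrite /g reflectK divE mulrN mulNr.
apply/measurable_EFinP; apply: measurable_sum => y; apply: measurable_funM => //.
exact: measurable_funN (measurable_fun_reflect (mf y)).
Qed.

(** [x] selects the endpoint whose mass weights the edge: the tail originally, the head after
    reversal. *)
Lemma measurable_Phi_sum (m : V -> R -> R) (b : V -> V -> R -> R) (x : V -> V -> V) :
  (forall y, measurable_fun I0 (m y)) -> (forall y t, I0 t -> 0 <= m y t) ->
  (forall y z, E y z -> measurable_fun I0 (b y z)) ->
  (forall y z t, E y z -> I0 t -> 0 <= b y z t) ->
  measurable_fun I0 (fun t => \sum_(y : V) \sum_(z : V | E y z)
    Phi (Q y z t) (m (x y z) t * b y z t))%E.
Proof.
move=> mm m0 mb b0; apply: emeasurable_sumP => y _; apply: emeasurable_sumP => z Eyz.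
apply: measurable_Phi => //.
- exact: Lambda_Q_meas.
- by apply: measurable_funM => //; exact: mb.
- by move=> t /I0P; exact: Lambda_Q_ge0.
- by move=> t It; rewrite mulr_ge0 ?m0 ?b0.
Qed.

Lemma Phi_sum_ge0 (m : V -> R -> R) (b : V -> V -> R -> R) (x : V -> V -> V) t :
  (forall y t, I0 t -> 0 <= m y t) ->
  (forall y z t, E y z -> I0 t -> 0 <= b y z t) -> I0 t ->
  (0 <= \sum_(y : V) \sum_(z : V | E y z) Phi (Q y z t) (m (x y z) t * b y z t))%E.
Proof.
move=> m0 b0 It; apply: sume_ge0 => y _; apply: sume_ge0 => z Eyz.
by apply: Phi_ge0; [apply: Lambda_Q_ge0 => //; exact/I0P|rewrite mulr_ge0 ?m0 ?b0].
Qed.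

(** Reflecting time and exchanging the endpoints of each edge brings the reversed pair back to [mu]
    and [Q]; what remains of the reversal is the mass at the head and the rate [b]. *)
Lemma Ifun_theta (r' b : V -> V -> R -> R) :
  (forall y z, E y z -> measurable_fun I0 (b y z)) ->
  (forall y z t, E y z -> I0 t -> 0 <= b y z t) ->
  (forall y z t, E y z -> I0 t -> r' z y (T0 - t) = b y z t) ->
  Ifun T0 E r' (thmu T0 mu) (thQ T0 Q) =
  (\int[leb]_(t in I0) \sum_(y : V) \sum_(z : V | E y z) Phi (Q y z t) (mu z t * b y z t))%E.
Proof.
move=> mb b0 r'b; rewrite /Ifun (asboolT theta_Lambda).
pose G t := (\sum_(y : V) \sum_(z : V | E y z) Phi (Q y z t) (mu z t * b y z t))%E.
rewrite -[RHS](@integral_reflect _ T0 G); last first.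
  apply: (@measurable_Phi_sum mu b (fun y z => z)) => //.
    exact: Lambda_mu_meas.
  by move=> y t /I0P; exact: Lambda_mu_ge0.
apply: eq_integral => t /set_mem It; rewrite /G (edge_sum_swap E_sym).
apply: eq_bigr => y _; apply: eq_bigr => z Eyz.
rewrite /thQ /thmu -(r'b _ _ _ Eyz) ?reflectK//.
exact/I0_reflectP.
Qed.

Lemma Lambda_swap (a b : V -> V -> R -> R) (c C : R) : 0 < c ->
  (forall y z, E y z -> measurable_fun I0 (a y z)) ->
  (forall y z, E y z -> measurable_fun I0 (b y z)) ->
  (forall y z t, E y z -> I0 t -> c <= a y z t <= C) ->
  (forall y z t, E y z -> I0 t -> c <= b y z t <= C) ->
  (\int[leb]_(t in I0) \sum_(y : V) \sum_(z : V | E y z) Phi (Q y z t) (mu z t * b y z t) =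
   \int[leb]_(t in I0) \sum_(y : V) \sum_(z : V | E y z) Phi (Q y z t) (mu y t * a y z t) +
   (\sum_(y : V) \sum_(z : V | E y z)
      Rintegral leb I0 (fun t => Q y z t * ln (a y z t / b y z t))
    + \sum_(y : V) Rintegral leb I0 (fun t => mu y t *
       (\sum_(z : V | E z y) b z y t - \sum_(z : V | E y z) a y z t)))%:E)%E.
Proof.
move=> c0 ma mb ab bb.
(* The identity above asks for masses in [0, 1] at every time, whereas [mu] satisfies this bound
   only almost everywhere. The truncation changes no integral. *)
pose m y t := Num.min (mu y t) 1.
have mm y : measurable_fun I0 (m y) by apply: measurable_minr => //; exact: Lambda_mu_meas.
have m01 y t : I0 t -> 0 <= m y t <= 1.
  by move=> /I0P It; rewrite /m le_min Lambda_mu_ge0// ler01 ge_min lexx orbT.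
have m0 y t : I0 t -> 0 <= m y t by move=> /(m01 y)/andP[].
have mu0 y t : I0 t -> 0 <= mu y t by move=> /I0P; exact: Lambda_mu_ge0.
have a0 y z t : E y z -> I0 t -> 0 <= a y z t.
  by move=> Eyz It; have /andP[h _] := ab y z t Eyz It; exact: le_trans (ltW c0) h.
have b0 y z t : E y z -> I0 t -> 0 <= b y z t.
  by move=> Eyz It; have /andP[h _] := bb y z t Eyz It; exact: le_trans (ltW c0) h.
have mE : {ae leb, forall t, I0 t -> forall y, mu y t = m y t}.
  apply: ae_weaken Lambda_mu_le1 => t h It y; by rewrite /m min_l// h.
have PhiE (k : V -> V -> R -> R) (x : V -> V -> V) :
    (forall y z, E y z -> measurable_fun I0 (k y z)) ->
    (forall y z t, E y z -> I0 t -> 0 <= k y z t) ->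
    (\int[leb]_(t in I0) \sum_(y : V) \sum_(z : V | E y z) Phi (Q y z t) (mu (x y z) t * k y z t) =
     \int[leb]_(t in I0) \sum_(y : V) \sum_(z : V | E y z) Phi (Q y z t) (m (x y z) t * k y z t))%E.
  move=> mk k0; apply: ge0_ae_eq_integral => //.
  - by apply: measurable_Phi_sum => // y; exact: Lambda_mu_meas.
  - exact: measurable_Phi_sum.
  - by move=> t It; exact: Phi_sum_ge0.
  - by move=> t It; exact: Phi_sum_ge0.
  - apply: ae_weaken mE => t h It.
    by apply: eq_bigr => y _; apply: eq_bigr => z _; rewrite (h It).
rewrite (PhiE b (fun y z => z))// (PhiE a (fun y z => y))//.
have mab y : measurable_fun I0
    (fun t => \sum_(z : V | E z y) b z y t - \sum_(z : V | E y z) a y z t).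
  by apply: measurable_funB; apply: measurable_sumP => z Ez; [exact: mb|exact: ma].
have -> : \sum_(y : V) Rintegral leb I0 (fun t => mu y t *
       (\sum_(z : V | E z y) b z y t - \sum_(z : V | E y z) a y z t)) =
    \sum_(y : V) Rintegral leb I0 (fun t => m y t *
       (\sum_(z : V | E z y) b z y t - \sum_(z : V | E y z) a y z t)).
  apply: eq_bigr => y _; apply: eq_Rintegral_ae.
  - by apply: measurable_funM => //; exact: Lambda_mu_meas.
  - exact: measurable_funM.
  - by apply: ae_weaken mE => t h It; rewrite h.
have [N [mN N0 NP]] := Lambda_zero.
apply: (integral_Phi_swap mI0 I0fin E_sym _ _ _ _ _ mN N0 _ c0 (C := C)) => //.
- exact: Lambda_Q_int.
- by move=> y z t Eyz /I0P; exact: Lambda_Q_ge0.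
- move=> del y del0; have := integral_log_divergence T0_gt0 (Lambda_mu_int y)
    (Lambda_divQ_int y) (@Lambda_weak y) (@Lambda_mu_ge0 y) del0.
  move=> <-; apply: eq_Rintegral_ae.
  + apply: measurable_funM; first exact: (integrable_measurable_fun (Lambda_divQ_int y)).
    by apply: (measurableT_comp (@measurable_ln R)); exact: measurable_funD.
  + apply: measurable_funM; first exact: (integrable_measurable_fun (Lambda_divQ_int y)).
    apply: (measurableT_comp (@measurable_ln R)); apply: measurable_funD => //.
    exact: Lambda_mu_meas.
  + by apply: ae_weaken mE => t h It; rewrite h.
- move=> t It Nt y z Eyz.
  have /= h : I0 t -> forall y z, E y z ->
    (mu y t = 0 -> Q y z t = 0) /\ (mu z t = 0 -> Q y z t = 0).
    by apply: contrapT => nP; apply: Nt; exact: NP.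
  have mm0 x : m x t = 0 -> mu x t = 0.
    by rewrite /m; case: (leP (mu x t) 1) => // _ /eqP; rewrite oner_eq0.
  by have [h1 h2] := h It y z Eyz; split => /mm0; [exact: h1|exact: h2].
Qed.

Lemma integrable_Qln_ratio y z (p q : R -> R) (c C : R) : E y z -> 0 < c ->
  measurable_fun I0 p -> measurable_fun I0 q ->
  (forall t, I0 t -> c <= p t <= C) -> (forall t, I0 t -> c <= q t <= C) ->
  leb.-integrable I0 (EFin \o (fun t => Q y z t * ln (p t / q t))).
Proof.
move=> Eyz c0 mp mq pb qb.
have p0 t : I0 t -> 0 < p t by move=> /pb/andP[h _]; exact: lt_le_trans h.
have q0 t : I0 t -> 0 < q t by move=> /qb/andP[h _]; exact: lt_le_trans h.
have ip := integrable_Mln mI0 (Lambda_Q_int Eyz) mp c0 pb.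
have iq := integrable_Mln mI0 (Lambda_Q_int Eyz) mq c0 qb.
have := integrableB_real mI0 ip iq; apply: eq_integrable => // t /set_mem It.
by rewrite /= -mulrBr ln_div ?posrE ?p0 ?q0.
Qed.

End OnePair.

Lemma thmuK (mu : V -> R -> R) : thmu T0 (thmu T0 mu) = mu.
Proof. by apply/funext => y; apply/funext => t; rewrite /thmu reflectK. Qed.

Lemma thQK (Q : V -> V -> R -> R) : thQ T0 (thQ T0 Q) = Q.
Proof. by do 3!apply/funext => ?; rewrite /thQ reflectK. Qed.

(** Reversal exchanges the constraints [S = s] and [S' = - s] inside Lambda and shifts the
    functional by [s]. Each inequality sends a competitor of one infimum to a competitor of the
    other; outside Lambda the value [+oo] makes the bound trivial. *)
Lemma ereal_inf_contraction (S S' : (V -> R -> R) -> (V -> V -> R -> R) -> R)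
    (r r' : V -> V -> R -> R) (s : R) :
  (forall mu Q, in_Lambda T0 E mu Q ->
    Ifun T0 E r' (thmu T0 mu) (thQ T0 Q) = (Ifun T0 E r mu Q + (S mu Q)%:E)%E) ->
  (forall mu Q, in_Lambda T0 E mu Q -> S' (thmu T0 mu) (thQ T0 Q) = - S mu Q) ->
  ereal_inf [set e | exists mu Q, S' mu Q = - s /\ e = Ifun T0 E r' mu Q] =
  (ereal_inf [set e | exists mu Q, S mu Q = s /\ e = Ifun T0 E r mu Q] + s%:E)%E.
Proof.
move=> IS SS'; apply/eqP; rewrite eq_le; apply/andP; split.
  rewrite -leeBlDr//; apply: le_ereal_inf_tmp => _ [mu [Q [Ss ->]]].
  have [L|nL] := pselect (in_Lambda T0 E mu Q); last by rewrite /Ifun (asboolF nL) leey.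
  rewrite leeBlDr//; apply: ereal_inf_lbound.
  exists (thmu T0 mu), (thQ T0 Q); split; first by rewrite SS'// Ss.
  by rewrite IS// Ss.
apply: le_ereal_inf_tmp => _ [mu [Q [Ss ->]]].
have [L|nL] := pselect (in_Lambda T0 E mu Q); last by rewrite /Ifun (asboolF nL) leey.
have L' := theta_Lambda L.
have S_th : S (thmu T0 mu) (thQ T0 Q) = s.
  by have := SS' _ _ L'; rewrite thmuK thQK Ss => /oppr_inj ->.
rewrite -[mu in leRHS]thmuK -[Q in leRHS]thQK IS// S_th leeD2r//.
by apply: ereal_inf_lbound; exists (thmu T0 mu), (thQ T0 Q).
Qed.

End LambdaFacts.

(** * The three protocols *)

Section Protocols.
Variables (R : realType) (V : finType) (T0 : R) (E : rel V).
Variables (r : V -> V -> R -> R) (w : R -> V -> R).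
Hypothesis T0_gt0 : 0 < T0.
Hypothesis rA : rates_assumptions T0 E r.
Hypothesis E_sym : symmetric_E E.
Hypothesis wI : forall t, invariant_distribution r t (w t).
Notation leb := (@leb R).
Notation I0 := (@I0 R T0).

Let mI0 := @measurable_I0_leb R T0.
Let r_off y z : ~~ E y z -> forall t, r y z t = 0.
Proof. exact: rA.2.2.2.2.2.1. Qed.
Let E' y z : E y z -> E z y. Proof. by rewrite E_sym. Qed.

Let r_meas y z : measurable_fun I0 (r y z).
Proof. by apply: measurable_funTS; exact: rA.1. Qed.
Let r_refl_meas y z : measurable_fun I0 (fun t => r y z (T0 - t)).
Proof. exact: measurable_fun_reflect. Qed.

Lemma rout_edges y t : rout r y t = \sum_(z : V | E y z) r y z t.
Proof.
rewrite /rout [RHS]big_mkcond/=; apply: eq_bigr => z _.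
by case: ifPn => // /r_off ->.
Qed.

Lemma rout_edges_in y t : rout r y t = \sum_(z : V | E z y) r y z t.
Proof. by rewrite rout_edges; apply: eq_bigl => z; rewrite E_sym. Qed.

Lemma measurable_rout y : measurable_fun I0 (rout r y).
Proof. by apply: measurable_sum => z; exact: r_meas. Qed.

Lemma invariant_uniform_bound : exists2 k : R, 0 < k & forall y t, I0 t -> k <= w t y <= 1.
Proof.
pose k z := s2val (cid2 (invariant_lower_bound rA wI z)).
have k0 z : 0 < k z by rewrite /k; case: cid2.
have kP z t : I0 t -> k z <= w t z.
  by move=> /I0P; rewrite /k; case: cid2 => /= ? _; exact.
have S0 : 0 < 1 + \sum_z (k z)^-1.
  by rewrite ltr_wpDr// sumr_ge0// => z _; rewrite invr_ge0 ltW.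
(* A common lower bound of the finitely many [k z]; the summand 1 makes the divisor positive without
   choosing a vertex. *)
exists (1 + \sum_z (k z)^-1)^-1 => [|y t It]; first by rewrite invr_gt0.
rewrite (invariant_le1 wI) andbT; apply: le_trans (kP y t It).
rewrite -[leRHS]invrK lef_pV2 ?posrE ?invr_gt0// (bigD1 y)//= addrCA lerDl.
by rewrite addr_ge0// sumr_ge0// => z _; rewrite invr_ge0 ltW.
Qed.

Section Identities.
Variables (mu : V -> R -> R) (Q : V -> V -> R -> R).
Hypothesis L : in_Lambda T0 E mu Q.

Let Q_int y z := @Lambda_Q_int _ _ _ _ _ _ L y z.

Let IfunE : Ifun T0 E r mu Q = (\int[leb]_(t in I0)
  \sum_(y : V) \sum_(z : V | E y z) Phi (Q y z t) (mu y t * r y z t))%E.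
Proof. by rewrite /Ifun (asboolT L). Qed.

Lemma integrable_mu_rout y : leb.-integrable I0
  (EFin \o (fun s => mu y s * (rout r y s - rout r y (T0 - s)))).
Proof.
have [M M0 HM] := rout_le rA.
have rb t : I0 t -> `|rout r y t| <= M.
  move=> /I0P It; rewrite ger0_norm; first exact: HM.
  by apply: sumr_ge0 => z _; exact: rA.2.1.
apply: (integrableM_bounded (C := M + M)) => //.
- exact: (Lambda_mu_int L).
- apply: measurable_funB; first exact: measurable_rout.
  exact: (measurable_fun_reflect (measurable_rout y)).
- move=> t It; apply: (le_trans (ler_normB _ _)); apply: lerD; first exact: rb.
  by apply: rb; exact/I0_reflectP.
Qed.

(** With unchanged rates the reversed edge rate is [r z y (T0 - t)], so the escape rates are
    compared at reflected times and their difference survives in the entropy. *)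
Lemma Ifun_naive : Ifun T0 E r (thmu T0 mu) (thQ T0 Q) =
  (Ifun T0 E r mu Q + (S_naive T0 E r mu Q)%:E)%E.
Proof.
have [[c C] /= c0 cb] := rates_bounds rA.
have ab y z t : E y z -> I0 t -> c <= r y z t <= C by move=> Eyz /I0P; exact: cb.
have bb y z t : E y z -> I0 t -> c <= r z y (T0 - t) <= C.
  by move=> /E' Ezy /I0_reflectP; exact: ab.
rewrite (Ifun_theta T0_gt0 E_sym L (b := fun y z t => r z y (T0 - t))); last 3 first.
- by move=> y z _; exact: r_refl_meas.
- by move=> y z t Eyz It; exact: rA.2.1.
- by [].
rewrite IfunE (Lambda_swap T0_gt0 E_sym L c0 (a := r) (C := C))//; congr (_ + _%:E)%E.
rewrite /S_naive; congr (_ + _); rewrite -sumrN; apply: eq_bigr => y _.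
have irout := integrable_mu_rout y.
rewrite -RintegralN_int//; apply: eq_Rintegral => t _.
by rewrite -mulrN opprB -rout_edges -rout_edges_in.
Qed.

(** Reversing the protocol undoes the reflection of time: the reversed edge rate is [r z y t], and
    the two escape rates cancel. *)
Lemma Ifun_tot : Ifun T0 E (rR T0 r) (thmu T0 mu) (thQ T0 Q) =
  (Ifun T0 E r mu Q + (S_tot T0 E r Q)%:E)%E.
Proof.
have [[c C] /= c0 cb] := rates_bounds rA.
have ab y z t : E y z -> I0 t -> c <= r y z t <= C by move=> Eyz /I0P; exact: cb.
have bb y z t : E y z -> I0 t -> c <= r z y t <= C by move=> /E' Ezy; exact: ab.
rewrite (Ifun_theta T0_gt0 E_sym L (b := fun y z t => r z y t)); last 3 first.
- by move=> y z _; exact: r_meas.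
- by move=> y z t Eyz It; exact: rA.2.1.
- by move=> y z t _ _; rewrite /rR reflectK.
rewrite IfunE (Lambda_swap T0_gt0 E_sym L c0 (a := r) (C := C))//; congr (_ + _%:E)%E.
rewrite /S_tot [X in _ + X]big1 ?addr0// => y _.
rewrite -[RHS](mul0r (fine (leb I0))) -Rintegral_cst//; apply: eq_Rintegral => t _.
by rewrite -rout_edges -rout_edges_in subrr mulr0.
Qed.

Lemma S_ex_edges : S_ex T0 E w Q = \sum_(y : V) \sum_(z : V | E y z)
  (Rintegral leb I0 (fun t => Q y z t * ln (w t z)) -
   Rintegral leb I0 (fun t => Q y z t * ln (w t y))).
Proof.
have [k k0 wb] := invariant_uniform_bound.
rewrite /S_ex (divergence_pairing mI0 E_sym Q_int (h := fun y t => w t y) k0 _ wb).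
  rewrite -sumrN; apply: eq_bigr => y _; rewrite -sumrN; apply: eq_bigr => z _.
  by rewrite opprB.
exact: measurable_invariant rA wI.
Qed.

(** The reversed edge rate is [r y z t * w t y / w t z]. The rates drop out of the logarithm,
    leaving a difference of [ln w] along the edge, which is the pairing defining [S_ex]. *)
Lemma Ifun_ex : Ifun T0 E (rDR T0 w r) (thmu T0 mu) (thQ T0 Q) =
  (Ifun T0 E r mu Q + (S_ex T0 E w Q)%:E)%E.
Proof.
have [[c C] /= c0 cb] := rates_bounds rA.
have [k k0 wb] := invariant_uniform_bound.
have w0 y t : I0 t -> 0 < w t y by move=> It; have /andP[h _] := wb y t It; exact: lt_le_trans h.
have k1 (y : V) t : I0 t -> k <= 1 by move=> It; have /andP[h1 h2] := wb y t It; exact: le_trans h2.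
have rpos y z t : E y z -> I0 t -> c <= r y z t <= C by move=> Eyz /I0P; exact: cb.
pose b y z t := (w t z)^-1 * r y z t * w t y.
have mw y : measurable_fun I0 (fun t => w t y) by exact: (measurable_invariant rA wI y).
(* Since [k <= w <= 1], the quotient [w t y / w t z] lies between [k] and [1 / k]; these bounds fit
   both [r] and [b]. *)
have ab y z t : E y z -> I0 t -> c * k <= r y z t <= C / k.
  move=> Eyz It; have /andP[h1 h2] := rpos y z t Eyz It; have kl := k1 y t It.
  have C0 : 0 <= C by rewrite (le_trans _ h2)// (le_trans _ h1)// ltW.
  apply/andP; split; first by apply: le_trans h1; rewrite ger_pMr.
  by apply: (le_trans h2); rewrite ler_peMr// invf_ge1.
have bb y z t : E y z -> I0 t -> c * k <= b y z t <= C / k.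
  move=> Eyz It; have /andP[h1 h2] := rpos y z t Eyz It; have kl := k1 y t It.
  have /andP[wz1 wz2] := wb z t It; have /andP[wy1 wy2] := wb y t It.
  have r0 : 0 < r y z t by exact: lt_le_trans h1.
  rewrite /b; apply/andP; split.
    apply: ler_pM => //; try exact: ltW.
    apply: (le_trans h1); rewrite ler_peMl ?(ltW r0)// invf_ge1//; exact: w0.
  rewrite -[leRHS]mulr1; apply: ler_pM => //.
  - by rewrite mulr_ge0 ?invr_ge0 ?ltW// w0.
  - exact/ltW/w0.
  - rewrite mulrC; apply: ler_pM => //; rewrite ?invr_ge0 ?(ltW r0) ?(ltW (w0 _ _ _))//.
    by rewrite lef_pV2 ?posrE ?w0.
have mb y z : measurable_fun I0 (b y z).
  apply: measurable_funM => //; apply: measurable_funM => //.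
  by apply: measurable_invr => // t It; rewrite gt_eqF// w0.
rewrite (Ifun_theta T0_gt0 E_sym L (b := b)); last 3 first.
- by move=> y z _; exact: mb.
- move=> y z t Eyz It; have /andP[h _] := bb y z t Eyz It.
  by apply: le_trans h; rewrite ltW// mulr_gt0.
- by move=> y z t _ _; rewrite /rDR /b reflectK.
rewrite IfunE (Lambda_swap T0_gt0 E_sym L (mulr_gt0 c0 k0) (a := r) (C := C / k))//.
congr (_ + _%:E)%E.
rewrite [X in _ + X]big1 ?addr0; last first.
  move=> y _; rewrite -[RHS](mul0r (fine (leb I0))) -Rintegral_cst//.
  apply: eq_Rintegral => t /set_mem It.
  have [_ _ wbal] := wI t.
  (* Stationarity of [w t]: the dual chain has the same escape rates. *)
  have -> : \sum_(z | E z y) b z y t = rout r y t.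
    rewrite /b; under eq_bigr do rewrite -mulrA.
    rewrite -mulr_sumr; have wn0 : w t y != 0 by rewrite gt_eqF// w0.
    apply: (mulfI wn0).
    rewrite mulVKf// -wbal [in RHS](bigID (fun z => E z y))/=.
    rewrite [X in _ + X]big1 ?addr0; last by move=> z /r_off ->; rewrite mulr0.
    by apply: eq_bigr => z _; rewrite mulrC.
  by rewrite -rout_edges subrr mulr0.
rewrite S_ex_edges; apply: eq_bigr => y _; apply: eq_bigr => z Eyz.
rewrite -RintegralB//.
- apply: eq_Rintegral => t /set_mem It; rewrite -mulrBr /b.
  have r0 : 0 < r y z t by have /andP[h _] := rpos y z t Eyz It; exact: lt_le_trans h.
  rewrite -ln_div ?posrE ?w0//; congr (_ * ln _).
  by field; rewrite !gt_eqF ?w0.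
- exact: (integrable_Mln mI0 (Q_int Eyz) (mw z) k0 (wb z)).
- exact: (integrable_Mln mI0 (Q_int Eyz) (mw y) k0 (wb y)).
Qed.

(** The integral is invariant under reflection, and inverting the quotient changes the sign of the
    logarithm. *)
Let flip_term y z (p q : R -> R) (c C : R) : E y z -> 0 < c ->
  measurable_fun I0 p -> measurable_fun I0 q ->
  (forall t, I0 t -> c <= p t <= C) -> (forall t, I0 t -> c <= q t <= C) ->
  Rintegral leb I0 (fun t => Q y z (T0 - t) * ln (q (T0 - t) / p (T0 - t))) =
  - Rintegral leb I0 (fun t => Q y z t * ln (p t / q t)).
Proof.
move=> Eyz c0 mp mq pb qb.
have ipq := integrable_Qln_ratio L Eyz c0 mp mq pb qb.
have iqp := integrable_Qln_ratio L Eyz c0 mq mp qb pb.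
rewrite (@Rintegral_reflect _ T0 (fun t => Q y z t * ln (q t / p t))); last first.
  exact: (integrable_measurable_fun iqp).
rewrite -RintegralN_int//; apply: eq_Rintegral => t /set_mem It.
have p0 : 0 < p t by have /andP[h _] := pb t It; exact: lt_le_trans h.
have q0 : 0 < q t by have /andP[h _] := qb t It; exact: lt_le_trans h.
by rewrite -mulrN -lnV ?posrE ?divr_gt0// invf_div.
Qed.

Lemma S_naive_theta : S_naive T0 E r (thmu T0 mu) (thQ T0 Q) = - S_naive T0 E r mu Q.
Proof.
have [[c C] /= c0 cb] := rates_bounds rA.
have ab y z t : E y z -> I0 t -> c <= r y z t <= C by move=> Eyz /I0P; exact: cb.
rewrite /S_naive [RHS]opprD; congr (_ + _); last congr (- _).
- rewrite (edge_sum_swap E_sym) -sumrN; apply: eq_bigr => y _.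
  rewrite -sumrN; apply: eq_bigr => z Eyz.
  rewrite -(flip_term (p := r y z) (q := fun t => r z y (T0 - t)) Eyz c0 (C := C))//.
  + by apply: eq_Rintegral => t _; rewrite /thQ reflectK.
  + by move=> t; exact: ab.
  + by move=> t /I0_reflectP; apply: ab; exact: E'.
- rewrite -sumrN; apply: eq_bigr => y _.
  have irout := integrable_mu_rout y.
  rewrite -RintegralN_int//.
  rewrite -(@Rintegral_reflect _ T0 (fun t => - (mu y t * (rout r y t - rout r y (T0 - t)))));
    last by apply: measurable_funN; exact: (integrable_measurable_fun irout).
  by apply: eq_Rintegral => t _; rewrite reflectK -mulrN opprB.
Qed.

Lemma S_tot_theta : S_tot T0 E (rR T0 r) (thQ T0 Q) = - S_tot T0 E r Q.
Proof.
have [[c C] /= c0 cb] := rates_bounds rA.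
have ab y z t : E y z -> I0 t -> c <= r y z t <= C by move=> Eyz /I0P; exact: cb.
rewrite /S_tot (edge_sum_swap E_sym) -sumrN; apply: eq_bigr => y _.
rewrite -sumrN; apply: eq_bigr => z Eyz.
rewrite -(flip_term (p := r y z) (q := r z y) Eyz c0 (C := C))//.
- by move=> t; exact: ab.
- by move=> t; apply: ab; exact: E'.
Qed.

(** Reversal changes the sign of the divergence and only reflects [ln w]. *)
Lemma S_ex_theta : S_ex T0 E (fun t => w (T0 - t)) (thQ T0 Q) = - S_ex T0 E w Q.
Proof.
have [k k0 wb] := invariant_uniform_bound.
rewrite /S_ex; congr (- _); rewrite -sumrN; apply: eq_bigr => y _.
have mw := measurable_invariant rA wI y.
have di := Lambda_divQ_int L y.
have dwi := integrable_Mln mI0 di mw k0 (wb y).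
rewrite -RintegralN_int//.
rewrite -(@Rintegral_reflect _ T0 (fun t => - (divQ E Q y t * ln (w t y)))); last first.
  apply: measurable_funN; exact: (integrable_measurable_fun dwi).
apply: eq_Rintegral => t _; rewrite -mulNr; congr (_ * _).
rewrite /divQ /thQ opprB; congr (_ - _); apply: eq_bigl => z; exact: E_sym.
Qed.

End Identities.
End Protocols.

Theorem theorem4 (R : realType) (V : finType) (T0 : R) (E : rel V)
    (r : V -> V -> R -> R) (w : R -> V -> R) :
  0 < T0 ->
  rates_assumptions T0 E r ->
  symmetric_E E ->
  (forall t, invariant_distribution r t (w t)) ->
  (forall (mu : V -> R -> R) (Q : V -> V -> R -> R), in_Lambda T0 E mu Q ->
     [/\ Ifun T0 E r (thmu T0 mu) (thQ T0 Q) =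
           (Ifun T0 E r mu Q + (S_naive T0 E r mu Q)%:E)%E,
         Ifun T0 E (rR T0 r) (thmu T0 mu) (thQ T0 Q) =
           (Ifun T0 E r mu Q + (S_tot T0 E r Q)%:E)%E &
         Ifun T0 E (rDR T0 w r) (thmu T0 mu) (thQ T0 Q) =
           (Ifun T0 E r mu Q + (S_ex T0 E w Q)%:E)%E]) /\
  (forall s : R,
     [/\ I_naive T0 E r (- s) = (I_naive T0 E r s + s%:E)%E,
         I_tot T0 E (rR T0 r) (- s) = (I_tot T0 E r s + s%:E)%E &
         I_ex T0 E (fun t => w (T0 - t)) (rDR T0 w r) (- s) =
           (I_ex T0 E w r s + s%:E)%E]).
Proof.
move=> T0_gt0 rA E_sym wI; split => [mu Q L|s].
  split; [exact: Ifun_naive|exact: Ifun_tot|exact: Ifun_ex].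
split.
- apply: (ereal_inf_contraction T0_gt0 E_sym (S := S_naive T0 E r)) => mu Q L.
    exact: Ifun_naive.
  exact: S_naive_theta.
- apply: (ereal_inf_contraction T0_gt0 E_sym (S := fun _ => S_tot T0 E r)
    (S' := fun _ => S_tot T0 E (rR T0 r))) => mu Q L.
    exact: Ifun_tot.
  exact: S_tot_theta rA E_sym _ _ L.
- apply: (ereal_inf_contraction T0_gt0 E_sym (S := fun _ => S_ex T0 E w)
    (S' := fun _ => S_ex T0 E (fun t => w (T0 - t)))) => mu Q L.
    exact: Ifun_ex.
  exact: S_ex_theta rA E_sym wI _ _ L.
Qed.
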